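(* Let $q$ be a power of a prime $p$ and $K$ an algebraic closure of $\mathbb{F}_q$, with $\mathrm{PGL}(3,q)$ acting on $\mathrm{PG}(2,K)$. Then $d(\mathrm{PGL}(3,q))=q^3-q^2$, $\varepsilon(\mathrm{PGL}(3,q))=q^2-q$, and the DGZ curve is the only $\mathrm{PGL}(3,q)$-invariant irreducible plane curve of degree $q^3-q^2$.
   Context: Plane curves are over $K$; irreducible means irreducible over $K$; $G$-invariant means mapped onto itself by every element of $G$. $d(G)$ is the smallest degree of a $G$-invariant irreducible plane curve other than a line; $\varepsilon(G)=d'(G)-d(G)$ where $d'(G)$ is the smallest degree larger than $d(G)$ of a $G$-invariant irreducible plane curve. The DGZ curve has affine equation $\frac{(X^{q^3}-X)(Y^{q}-Y)-(Y^{q^3}-Y)(X^{q}-X)}{(X^{q^2}-X)(Y^q-Y)-(Y^{q^2}-Y)(X^q-X)}=0$ (exact polynomial quotient). *)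

(* Defs.v *)
From HB Require Import structures.
From mathcomp Require Import all_boot all_order all_algebra.
From mathcomp Require Import mpoly.
Set Implicit Arguments. Unset Strict Implicit. Unset Printing Implicit Defensive.
Import Order.TTheory GRing.Theory.
Local Open Scope ring_scope.

Section Curves.
Variable K : closedFieldType.

(* K is an algebraic closure of F_q: algebraically closed, and every element
   lies in some finite extension F_{q^n} of F_q. *)
Definition alg_closure_of_Fq (p q : nat) : Prop :=
  [/\ prime p, p \in [pchar K], (exists k, (0 < k)%N /\ q = (p ^ k)%N)
    & forall x : K, exists n, (0 < n)%N /\ x ^+ (q ^ n) = x].

(* Homogeneous coordinates X_0 = X, X_1 = Y, X_2 = Z.
   A nonzero homogeneous polynomial of degree n (defines a plane curve of degree n). *)
Definition homog_deg (n : nat) (F : {mpoly K[3]}) : Prop :=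
  F != 0 /\ forall m, m \in msupp F -> mdeg m = n.

Definition irreducible_mpoly (F : {mpoly K[3]}) : Prop :=
  (1 < msize F)%N /\
  forall A B : {mpoly K[3]}, F = A * B -> (msize A <= 1)%N \/ (msize B <= 1)%N.

(* Matrices of GL(3,q): invertible 3x3 matrices with entries in F_q
   (= {x in K | x^q = x}); their classes form PGL(3,q) acting on PG(2,K). *)
Definition GL3q (q : nat) (M : 'M[K]_3) : Prop :=
  (forall i j, M i j ^+ q = M i j) /\ \det M != 0.

Definition act (M : 'M[K]_3) (F : {mpoly K[3]}) : {mpoly K[3]} :=
  F \mPo [tuple \sum_(j < 3) (M i j)%:MP * 'X_j | i < 3].

Definition PGL3q_invariant (q : nat) (F : {mpoly K[3]}) : Prop :=
  forall M, GL3q q M -> exists c : K, c != 0 /\ act M F = c *: F.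

Definition inv_irr_deg (q n : nat) : Prop :=
  exists F, [/\ homog_deg n F, irreducible_mpoly F & PGL3q_invariant q F].

Definition is_d (q d : nat) : Prop :=
  [/\ d != 1%N, inv_irr_deg q d
    & forall m, m != 1%N -> inv_irr_deg q m -> (d <= m)%N].

Definition is_eps (q e : nat) : Prop :=
  exists d, [/\ is_d q d, (0 < e)%N, inv_irr_deg q (d + e)
    & forall m, (d < m)%N -> inv_irr_deg q m -> (d + e <= m)%N].

Definition dehom (F : {mpoly K[3]}) : {mpoly K[2]} :=
  F \mPo [tuple 'X_0; 'X_1; 1].

Definition DGZ_num (q : nat) : {mpoly K[2]} :=
  ('X_0 ^+ (q ^ 3) - 'X_0) * ('X_1 ^+ q - 'X_1)
  - ('X_1 ^+ (q ^ 3) - 'X_1) * ('X_0 ^+ q - 'X_0).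
Definition DGZ_den (q : nat) : {mpoly K[2]} :=
  ('X_0 ^+ (q ^ 2) - 'X_0) * ('X_1 ^+ q - 'X_1)
  - ('X_1 ^+ (q ^ 2) - 'X_1) * ('X_0 ^+ q - 'X_0).

(* The projective curve F = 0 (F homogeneous, irreducible, not the line Z) is the
   DGZ curve: its affine equation is a nonzero scalar multiple of the exact
   quotient DGZ_num / DGZ_den, i.e. dehom F * DGZ_den = c * DGZ_num. *)
Definition is_DGZ (q : nat) (F : {mpoly K[3]}) : Prop :=
  exists c : K, c != 0 /\ dehom F * DGZ_den q = c *: DGZ_num q.

End Curves.

(* Main.v *)
Require Import Defs.
From HB Require Import structures.
From mathcomp Require Import all_boot all_order all_algebra.
From mathcomp Require Import separable cyclic cyclotomic.
From mathcomp Require Import ring zify.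
From mathcomp Require Import mpoly.
Set Implicit Arguments. Unset Strict Implicit. Unset Printing Implicit Defensive.
Import GRing.Theory.
Local Open Scope ring_scope.

(** The candidates are the Dickson invariants of GL(3,q) of degrees q^3 - q^2 and
    q^3 - q, written W^(q-1) + D^q and D W^(q-1) + M^q, where
    W = X^(q^2) - D X^q + M X is the product of the q^2 forms X + aY + bZ (a, b in F_q)
    and D, M are the analogous invariants of the pair (Y, Z). The first one is the DGZ
    curve, because all these forms are quotients of Moore determinants.

    Lower bound and uniqueness: invariance under X -> X + aY + bZ makes F(X,Y,1) a
    polynomial in W over K[Y], and the diagonal matrices force exponents to be multiples
    of q - 1. If F(1,0,0) <> 0, this gives q^2 (q-1) | deg F, and F is determined up to
    a scalar when deg F = q^2 (q-1). If F(1,0,0) = 0, then F(0,Y,1) is a nonzero polynomial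
    in (Y^q - Y)^q vanishing at 0, which gives deg F >= q^3 - q.

    Irreducibility: the form of degree q^3 - q satisfies Eisenstein's criterion, read
    from the leading coefficient D. If the DGZ form is A B, then A and B do not meet on
    the line X = 0, so by Hensel uniqueness both are fixed by the elations with this axis,
    and by symmetry by all elations; hence q^2 (q-1) divides both degrees. *)

(** * Dickson forms *)

Section DicksonForms.
Variables (R : comNzRingType) (q : nat).
Implicit Types x y z : R.

(** [dV y z] is the product of the q forms y + bz with b in F_q. *)
Definition dV y z := y ^+ q - y * z ^+ q.-1.
Definition dD y z := dV y z ^+ q.-1 + z ^+ (q * q.-1).
Definition dM y z := (z * dV y z) ^+ q.-1.
Definition dW x y z := x ^+ (q ^ 2) - dD y z * x ^+ q + dM y z * x.
Definition dC2 x y z := dW x y z ^+ q.-1 + dD y z ^+ q.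
Definition dC1 x y z := dD y z * dW x y z ^+ q.-1 + dM y z ^+ q.

(** Determinant of the matrix with rows (x, y, z), their a-th powers and their b-th powers, expanded
    along the column of x. *)
Definition moore a b x y z :=
  x * (y ^+ a * z ^+ b - y ^+ b * z ^+ a)
  - x ^+ a * (y * z ^+ b - y ^+ b * z) + x ^+ b * (y * z ^+ a - y ^+ a * z).

Hypothesis q_gt0 : (0 < q)%N.
(** Characteristic p enters this section through the additivity of x^q alone, so the identities
    apply to K and to every polynomial ring over it. *)
Hypothesis frobD : {morph (fun x : R => x ^+ q) : x y / x + y}.

Lemma frob0 : (0 : R) ^+ q = 0.
Proof. by rewrite expr0n; case: q q_gt0. Qed.

Lemma frobN : {morph (fun x : R => x ^+ q) : x / - x}.
Proof. by move=> x; apply/eqP; rewrite -addr_eq0 -frobD addNr frob0. Qed.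

Lemma frobB : {morph (fun x : R => x ^+ q) : x y / x - y}.
Proof. by move=> x y; rewrite frobD frobN. Qed.

Lemma exprq2 x : x ^+ (q ^ 2) = (x ^+ q) ^+ q.
Proof. by rewrite -exprM mulnn. Qed.

Lemma exprq3 x : x ^+ (q ^ 3) = (x ^+ (q ^ 2)) ^+ q.
Proof. by rewrite -exprM -expnSr. Qed.

Lemma expr_predq x : x ^+ q.-1 * x = x ^+ q.
Proof. by rewrite -exprSr prednK. Qed.

Lemma dW_add x x' y z : dW (x + x') y z = dW x y z + dW x' y z.
Proof. rewrite /dW !exprq2 !frobD; ring. Qed.

Lemma dW_scale c x y z : c ^+ q = c -> dW (c * x) y z = c * dW x y z.
Proof. by move=> cq; rewrite /dW !exprq2 !exprMn !cq; ring. Qed.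

Lemma dW_y y z : dW y y z = 0.
Proof.
have -> : dW y y z = dV y z ^+ q - dV y z ^+ q.-1 * dV y z.
  rewrite /dW /dD exprM /dM exprMn.
  (* With V = [dV y z], expanding V^q by Frobenius shows that W at x = y is V^q - V^(q-1) V. *)
  have -> : dV y z ^+ q = y ^+ (q ^ 2) - y ^+ q * (z ^+ q) ^+ q.-1.
    by rewrite exprq2 {1}/dV frobB exprMn exprAC.
  rewrite {4}/dV; ring.
by rewrite expr_predq subrr.
Qed.

Lemma dW_z y z : dW z y z = 0.
Proof.
rewrite /dW /dD exprM /dM exprMn exprq2 -(expr_predq z) -(expr_predq (_ * z)).
rewrite exprMn; ring.
Qed.

(** Since y and z are roots of W in x, both satisfy the same linear recursion between u, u^q and
    u^(q^2); it reduces every Moore determinant to the minor y z^q - y^q z. *)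
Lemma exprq2_yE y z : y ^+ (q ^ 2) = dD y z * y ^+ q - dM y z * y.
Proof. by apply/eqP; rewrite -subr_eq0; apply/eqP; rewrite -[RHS](dW_y y z) /dW; ring. Qed.

Lemma exprq2_zE y z : z ^+ (q ^ 2) = dD y z * z ^+ q - dM y z * z.
Proof. by apply/eqP; rewrite -subr_eq0; apply/eqP; rewrite -[RHS](dW_z y z) /dW; ring. Qed.

Lemma moore12 x y z :
  moore q (q ^ 2) x y z = (y * z ^+ q - y ^+ q * z) * dW x y z.
Proof. rewrite /moore (exprq2_yE y z) (exprq2_zE y z) /dW; ring. Qed.

Lemma dW_frob x y z : dW x y z ^+ q =
  x ^+ (q ^ 3) - dD y z ^+ q * x ^+ (q ^ 2) + dM y z ^+ q * x ^+ q.
Proof. by rewrite /dW frobD frobB !exprMn exprq3 exprq2. Qed.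

Lemma dC2_moore x y z : dC2 x y z * moore q (q ^ 2) x y z = moore q (q ^ 3) x y z.
Proof.
(* In W^q + D^q W the term x^(q^2) cancels and the roots y, z persist; this makes it the Moore
   determinant with exponents 1, q, q^3 up to the minor of y and z. *)
have -> : moore q (q ^ 3) x y z = (y * z ^+ q - y ^+ q * z) *
    (dW x y z ^+ q + dD y z ^+ q * dW x y z).
  have y3 := exprq3 y; have z3 := exprq3 z; rewrite dW_frob.
  rewrite (exprq2_yE y z) frobB !exprMn -exprq2 (exprq2_yE y z) in y3.
  rewrite (exprq2_zE y z) frobB !exprMn -exprq2 (exprq2_zE y z) in z3.
  rewrite /moore y3 z3 /dW; ring.
rewrite moore12 /dC2 -(expr_predq (dW x y z)); ring.
Qed.

Lemma dC1_moore x y z :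
  dC1 x y z * moore q (q ^ 2) x y z = moore (q ^ 2) (q ^ 3) x y z.
Proof.
(* Here D W^q + M^q W is the combination in which x^q cancels. *)
have -> : moore (q ^ 2) (q ^ 3) x y z = (y * z ^+ q - y ^+ q * z) *
    (dD y z * dW x y z ^+ q + dM y z ^+ q * dW x y z).
  have y3 := exprq3 y; have z3 := exprq3 z; rewrite dW_frob.
  rewrite (exprq2_yE y z) frobB !exprMn -exprq2 (exprq2_yE y z) in y3.
  rewrite (exprq2_zE y z) frobB !exprMn -exprq2 (exprq2_zE y z) in z3.
  rewrite /moore y3 z3 (exprq2_yE y z) (exprq2_zE y z) /dW; ring.
rewrite moore12 /dC1 -(expr_predq (dW x y z)); ring.
Qed.

Lemma frob_iter k : {morph (fun x : R => x ^+ (q ^ k)) : x y / x + y}.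
Proof.
elim: k => [|k IH] x y; first by rewrite /= !expr1.
by rewrite expnSr !exprM IH frobD.
Qed.

Lemma det3E (M : 'M[R]_3) : \det M =
  M 0 0 * (M 1 1 * M 2%:R 2%:R - M 1 2%:R * M 2%:R 1)
  - M 0 1 * (M 1 0 * M 2%:R 2%:R - M 1 2%:R * M 2%:R 0)
  + M 0 2%:R * (M 1 0 * M 2%:R 1 - M 1 1 * M 2%:R 0).
Proof.
(* Indexing the entries by natural numbers makes the lifted indices of the minors compute, so that
   [ring] can identify equal entries. *)
have [m mE] : {m : nat -> nat -> R | forall i j, M i j = m (val i) (val j)}.
  by exists (fun i j => M (inord i) (inord j)) => i j; rewrite !inord_val.
rewrite (expand_det_row _ 0) !big_ord_recl big_ord0 /cofactor.
rewrite !(expand_det_row _ 0) !big_ord_recl !big_ord0 /cofactor !det_mx11 !mxE.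
rewrite !mE /=; ring.
Qed.

Definition mx3 a b c d e f g h i : 'M[R]_3 :=
  \matrix_(k, l) nth 0 (nth [::] [:: [:: a; b; c]; [:: d; e; f]; [:: g; h; i]] k) l.

(** Entries of M fixed by Frobenius commute with raising to a power of q, so the Moore matrix of the
    transformed forms is a product with M. *)
Lemma moore_lin (M : 'M[R]_3) s t x y z :
  (forall i j, M i j ^+ q = M i j) ->
  let l i := M i 0 * x + M i 1 * y + M i 2%:R * z in
  moore (q ^ s) (q ^ t) (l 0) (l 1) (l 2%:R) =
  \det M * moore (q ^ s) (q ^ t) x y z.
Proof.
move=> Mq l.
have Mqk i j k : M i j ^+ (q ^ k) = M i j.
  by elim: k => [|k IH]; rewrite ?expr1 // expnSr exprM IH Mq.
rewrite /moore /l !frob_iter !exprMn !Mqk det3E; ring.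
Qed.

End DicksonForms.

(** The coefficients are pushed along [i] into an arbitrary commutative ring. One notion thus covers
    points, restrictions to lines, affine charts and linear substitutions. *)
Notation ev i x y z := (mmap i (tnth [tuple x; y; z])).

(** * Evaluation of ternary forms *)

Section Evaluation.
Variable K : closedFieldType.
Implicit Types (F G : {mpoly K[3]}) (S T : comNzRingType).

Lemma eq_mmap n S (f g : {rmorphism K -> S}) (h k : 'I_n -> S) (F : {mpoly K[n]}) :
  f =1 g -> h =1 k -> mmap f h F = mmap g k F.
Proof.
move=> fg hk; rewrite /mmap; apply: eq_bigr => m _; rewrite fg.
by congr (_ * _); apply: eq_bigr => j _; rewrite hk.
Qed.

Lemma tnth3P S (f : 'I_3 -> S) x y z :
  f 0 = x -> f 1 = y -> f 2%:R = z -> f =1 tnth [tuple x; y; z].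
Proof.
move=> <- <- <- [[|[|[|//]]] Hj]; rewrite (tnth_nth 0) /=; congr f; exact: val_inj.
Qed.

Lemma ev_X S (i : {rmorphism K -> S}) x y z :
  [/\ ev i x y z 'X_0 = x, ev i x y z 'X_1 = y & ev i x y z 'X_2%:R = z].
Proof. by split; rewrite mmapX mmap1U (tnth_nth 0). Qed.

Lemma ev_comp S T (g : {rmorphism S -> T}) (i : {rmorphism K -> S})
    (j : {rmorphism K -> T}) x y z x' y' z' F :
  g \o i =1 j -> g x = x' -> g y = y' -> g z = z' ->
  g (ev i x y z F) = ev j x' y' z' F.
Proof.
move=> gi <- <- <-; rewrite /mmap raddf_sum; apply: eq_bigr => m _ /=.
rewrite rmorphM rmorph_prod -gi; congr (_ * _); apply: eq_bigr => k _.
rewrite rmorphXn; congr (_ ^+ _); move: k.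
by apply: (@tnth3P _ (fun k => g (tnth _ k))); rewrite (tnth_nth 0).
Qed.

Lemma ev_id F : ev (@mpolyC 3 K) 'X_0 'X_1 'X_2%:R F = F.
Proof.
rewrite -[RHS]comp_mpoly_id; apply: eq_mmap => // k; apply/esym; move: k.
by apply: tnth3P; rewrite tnth_mktuple.
Qed.

Lemma actE M F : act M F = ev (@mpolyC 3 K)
  ((M 0 0)%:MP * 'X_0 + (M 0 1)%:MP * 'X_1 + (M 0 2%:R)%:MP * 'X_2%:R)
  ((M 1 0)%:MP * 'X_0 + (M 1 1)%:MP * 'X_1 + (M 1 2%:R)%:MP * 'X_2%:R)
  ((M 2%:R 0)%:MP * 'X_0 + (M 2%:R 1)%:MP * 'X_1 + (M 2%:R 2%:R)%:MP * 'X_2%:R) F.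
Proof.
have E i : \sum_(j < 3) (M i j)%:MP * 'X_j = (M i 0)%:MP * 'X_0 +
    (M i 1)%:MP * 'X_1 + (M i 2%:R)%:MP * 'X_2%:R :> {mpoly K[3]}.
  rewrite !big_ord_recl big_ord0 addr0 addrA.
  by do !congr (_ + _); congr ((M i _)%:MP * 'X_ _); apply: val_inj.
by apply: eq_mmap => //; apply: tnth3P; rewrite tnth_mktuple E.
Qed.

Lemma ev_act S (i : {rmorphism K -> S}) x y z M F :
  ev i x y z (act M F) = ev i (i (M 0 0) * x + i (M 0 1) * y + i (M 0 2%:R) * z)
    (i (M 1 0) * x + i (M 1 1) * y + i (M 1 2%:R) * z)
    (i (M 2%:R 0) * x + i (M 2%:R 1) * y + i (M 2%:R 2%:R) * z) F.
Proof.
have [X0 X1 X2] := ev_X i x y z.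
rewrite actE; apply: ev_comp; first by move=> c; apply: mmapC.
all: by rewrite !rmorphD !rmorphM /= !mmapC X0 X1 X2.
Qed.

Lemma ev_act_mx3 S (i : {rmorphism K -> S}) x y z a b c d e f g h k F :
  ev i x y z (act (mx3 a b c d e f g h k) F) =
  ev i (i a * x + i b * y + i c * z) (i d * x + i e * y + i f * z)
    (i g * x + i h * y + i k * z) F.
Proof. by rewrite ev_act !mxE. Qed.

Lemma dehomE F : dehom F = ev (@mpolyC 2 K) 'X_0 'X_1 1 F.
Proof. by apply: eq_mmap => //; apply: tnth3P; rewrite (tnth_nth 0). Qed.

Definition monX i j k : {mpoly K[3]} := 'X_0 ^+ i * 'X_1 ^+ j * 'X_2%:R ^+ k.

(** The property is additive, so it suffices to check it on monomials; homogeneity forces the third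
    exponent. *)
Lemma homog_expand m F : F \is m.-homog -> exists a : nat -> nat -> K,
  F = \sum_(i < m.+1) \sum_(j < (m - i).+1) a i j *: monX i j (m - i - j).
Proof.
move=> /dhomogP Fh.
pose E G := exists a : nat -> nat -> K,
  G = \sum_(i < m.+1) \sum_(j < (m - i).+1) a i j *: monX i j (m - i - j).
have E0 : E 0.
  by exists (fun _ _ => 0); rewrite big1 // => i _; rewrite big1 // => j _; rewrite scale0r.
have ED G H : E G -> E H -> E (G + H).
  move=> [a ->] [b ->]; exists (fun i j => a i j + b i j).
  rewrite -big_split; apply: eq_bigr => i _; rewrite -big_split.
  by apply: eq_bigr => j _; rewrite scalerDl.
rewrite -/(E F) (mpolyE F) big_seq; apply: big_ind => // mo /Fh {Fh}.
have mdegE : mdeg mo = (mo ord0 + (mo 1%R + mo 2%:R))%N.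
  rewrite mdegE !big_ord_recl big_ord0 addn0.
  by do 2!congr (_ + _)%N; congr (mo _); apply: val_inj.
move=> mom; have {mdegE}mdegE : (mo ord0 + (mo 1%R + mo 2%:R) = m)%N by rewrite -mdegE -mom.
exists (fun i j => (F@_mo) *+ ((i == mo ord0) && (j == mo 1%R))).
have lti : (mo ord0 < m.+1)%N by lia.
have ltj : (mo 1%R < (m - mo ord0).+1)%N by lia.
rewrite (bigD1 (Ordinal lti)) //= (bigD1 (Ordinal ltj)) //= !eqxx /=.
rewrite big1 => [|j]; last first.
  by rewrite -val_eqE /= => /negPf ->; rewrite mulr0n scale0r.
rewrite big1 => [|i]; last first.
  rewrite -val_eqE /= => /negPf ne; rewrite big1 // => j _.
  by rewrite ne /= mulr0n scale0r.
rewrite !addr0; congr (_ *: _); rewrite mpolyXE_id !big_ord_recl big_ord0 mulr1.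
have -> : (m - mo ord0 - mo 1%R = mo 2%:R)%N by lia.
rewrite /monX -mulrA; congr (_ * (_ * _)); congr ('X_ _ ^+ mo _); exact: val_inj.
Qed.

Lemma ev_expand S (i0 : {rmorphism K -> S}) x y z m (a : nat -> nat -> K) :
  ev i0 x y z (\sum_(i < m.+1) \sum_(j < (m - i).+1) a i j *: monX i j (m - i - j))
  = \sum_(i < m.+1) \sum_(j < (m - i).+1) i0 (a i j) * (x ^+ i * y ^+ j * z ^+ (m - i - j)).
Proof.
rewrite rmorph_sum; apply: eq_bigr => i _; rewrite rmorph_sum.
apply: eq_bigr => j _ /=; rewrite mmapZ !rmorphM !rmorphXn /=.
by have [-> -> ->] := ev_X i0 x y z.
Qed.

Lemma homog_degP m F : homog_deg m F <-> F != 0 /\ F \is m.-homog.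
Proof. by split=> -[F0 /dhomogP]. Qed.

(** The affine chart Z = 1 as a polynomial in X over K[Y]; degree in X, composition with W and
    reduction modulo X are then univariate notions. *)
Definition bi F : {poly {poly K}} := ev (@polyC _ \o @polyC K) 'X 'X%:P 1 F.

Lemma bi_poly m (a : nat -> nat -> K) : bi (\sum_(i < m.+1) \sum_(j < (m - i).+1) a i j *: monX i j (m - i - j))
  = \poly_(i < m.+1) \poly_(j < (m - i).+1) a i j.
Proof.
rewrite /bi ev_expand poly_def; apply: eq_bigr => i _.
rewrite -mul_polyC [in RHS]poly_def raddf_sum mulr_suml; apply: eq_bigr => j _.
by rewrite /= expr1n mulr1 -mul_polyC polyCM rmorphXn /= -mulrA [_ ^+ i * _]mulrC.
Qed.

Section Homogeneous.
Variables (m : nat) (F : {mpoly K[3]}).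
Hypothesis Fm : F \is m.-homog.

Lemma ev_homog S (i : {rmorphism K -> S}) t x y z :
  ev i (t * x) (t * y) (t * z) F = t ^+ m * ev i x y z F.
Proof.
have [a ->] := homog_expand Fm; rewrite !ev_expand mulr_sumr.
apply: eq_bigr => j _; rewrite mulr_sumr; apply: eq_bigr => k _.
rewrite !exprMn [in RHS]mulrCA; congr (_ * _).
have Et : t ^+ m = t ^+ j * t ^+ k * t ^+ (m - j - k).
  by rewrite -!exprD; congr (_ ^+ _); have := ltn_ord j; have := ltn_ord k; lia.
by rewrite Et; ring.
Qed.

End Homogeneous.
End Evaluation.

(** * Valuations at 0 and coefficients of homogeneous forms *)

Lemma poly_valuation (R : nzRingType) (p : {poly R}) : p != 0 ->
  exists k, exists2 r : {poly R}, r`_0 != 0 & p = r * 'X^k.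
Proof.
move=> p0; have [k [r]] := multiplicity_XsubC p 0.
by rewrite p0 rootE horner_coef0 subr0 => r0 ->; exists k, r.
Qed.

(** The right side has valuation exactly k, and X^j divides the left side. *)
Lemma poly_valuation_le (R : nzRingType) (r s : {poly R}) j k :
  s`_0 != 0 -> r * 'X^j = s * 'X^k -> (j <= k)%N.
Proof.
move=> s0 E; rewrite leqNgt; apply/negP => kj.
by have /eqP := congr1 (fun p : {poly R} => p`_k) E; rewrite /= !coefMXn kj ltnn subnn eq_sym (negPf s0).
Qed.

Section HomogeneousForms.
Variable K : closedFieldType.
Implicit Types (F G A B : {mpoly K[3]}).

Lemma bi_inj m F G : F \is m.-homog -> G \is m.-homog -> bi F = bi G -> F = G.
Proof.
move=> /homog_expand[a ->] /homog_expand[b ->]; rewrite !bi_poly => E.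
apply: eq_bigr => i _; apply: eq_bigr => j _; congr (_ *: _).
have := congr1 (fun p : {poly {poly K}} => p`_i`_j) E.
by rewrite /= !coef_poly ltn_ord !coef_poly ltn_ord.
Qed.

Section Coefficients.
Variables (m : nat) (F : {mpoly K[3]}).
Hypothesis Fm : F \is m.-homog.

Lemma size_bi : (size (bi F) <= m.+1)%N.
Proof. by have [a ->] := homog_expand Fm; rewrite bi_poly size_poly. Qed.

Lemma size_coef_bi i : (size ((bi F)`_i)%R <= m.+1 - i)%N.
Proof.
have [a ->] := homog_expand Fm; rewrite bi_poly coef_poly; case: ltnP => im.
  by rewrite subSn ?size_poly.
by rewrite size_poly0.
Qed.

Lemma coef_bi_top : (bi F)`_m = (ev idfun 1 0 0 F)%:P.
Proof.
have [a ->] := homog_expand Fm; rewrite bi_poly coef_poly ltnSn subnn.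
rewrite ev_expand (bigD1 ord_max) //= [X in _ + X]big1 => [|i]; last first.
  rewrite -val_eqE /= => im; rewrite big1 // => j _.
  have [j0|j0] := posnP j; last by rewrite (expr0n K j) gtn_eqF // mulr0 mul0r mulr0.
  rewrite (expr0n K (m - i - j)) gtn_eqF ?mulr0 // j0 subn0 subn_gt0.
  by rewrite ltn_neqAle im -ltnS ltn_ord.
rewrite addr0 (bigD1 (Ordinal (ltn0Sn (m - m)))) //= big1 => [|j].
  rewrite addr0 subnn subn0 !expr0 expr1n !mulr1.
  by apply/polyP => i; rewrite coef_poly coefC; case: i.
by rewrite -val_eqE /=; have := ltn_ord j; lia.
Qed.

Lemma bi_coef0 : (bi F)`_0 = ev (@polyC K) 0 'X 1 F.
Proof.
rewrite -horner_coef0 -horner_evalE; apply: ev_comp => [c|||];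
  by rewrite /= horner_evalE !hornerE.
Qed.

Lemma ev_line : exists a : nat -> K,
  forall (S : comNzRingType) (i : {rmorphism K -> S}) (y z : S),
  ev i 0 y z F = \sum_(j < m.+1) i (a j) * (y ^+ j * z ^+ (m - j)).
Proof.
have [a ->] := homog_expand Fm; exists (a 0%N) => S i y z; rewrite ev_expand.
rewrite big_ord_recl [X in _ + X]big1 => [|j _]; last first.
  by rewrite big1 // => k _; rewrite expr0n !mul0r mulr0.
rewrite addr0 /= !subn0; apply: eq_bigr => j _; rewrite expr0 mul1r ?subn0 //.
Qed.

Lemma size_ev_line : (size (ev (@polyC K) 0 'X 1 F)%R <= m.+1)%N.
Proof. by rewrite -bi_coef0 -[m.+1]subn0 size_coef_bi. Qed.

(** On the line X = 0, exchanging the roles of Y and Z reverses the list of coefficients of a binary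
    form of degree m. *)
Lemma coef_ev_line_rev j : (j <= m)%N ->
  (ev (@polyC K) 0 1 'X F)`_j = (ev (@polyC K) 0 'X 1 F)`_(m - j).
Proof.
move=> jm; have [a aE] := ev_line; rewrite !aE.
have -> : \sum_(k < m.+1) (a k)%:P * ('X ^+ k * 1 ^+ (m - k)) = \poly_(k < m.+1) a k.
  by rewrite poly_def; apply: eq_bigr => k _; rewrite expr1n mulr1 mul_polyC.
rewrite coef_poly ltnS leq_subr coef_sum.
have lt : (m - j < m.+1)%N by rewrite ltnS leq_subr.
rewrite (bigD1 (Ordinal lt)) //= big1 => [|k].
  by rewrite expr1n mul1r subKn // coefCM coefXn eqxx mulr1 addr0.
rewrite -val_eqE expr1n mul1r coefCM coefXn /= => kj; rewrite (_ : _ == _ = false) ?mulr0 //.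
by have := ltn_ord k; lia.
Qed.

Lemma coef_ev_line_top : (ev (@polyC K) 0 'X 1 F)`_m = ev idfun 0 1 0 F.
Proof.
rewrite -(subn0 m) -coef_ev_line_rev // -horner_coef0 -horner_evalE.
apply: ev_comp => [c|||]; by rewrite /= horner_evalE !hornerE.
Qed.

Lemma coef0_ev_line : (ev (@polyC K) 0 'X 1 F)`_0 = ev idfun 0 0 1 F.
Proof.
rewrite -horner_coef0 -horner_evalE.
apply: ev_comp => [c|||]; by rewrite /= horner_evalE !hornerE.
Qed.

Lemma ev_line0_divX : ev (@polyC K) 0 'X 1 F = 0 -> exists G, F = 'X_0 * G.
Proof.
move=> F0; have {F0}F0 : (bi F)`_0 = 0 by rewrite bi_coef0.
have [a Fa] := homog_expand Fm; rewrite Fa bi_poly coef_poly /= in F0.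
exists (\sum_(i < m) \sum_(j < (m - i.+1).+1) a i.+1 j *: monX K i j (m - i.+1 - j)).
rewrite Fa big_ord_recl big1 ?add0r => [|j _]; last first.
  have /= := congr1 (fun p : {poly K} => p`_j) F0.
  by rewrite coef0 coef_poly ltn_ord => ->; rewrite scale0r.
rewrite mulr_sumr; apply: eq_bigr => i _; rewrite mulr_sumr; apply: eq_bigr => j _.
by rewrite -scalerAr /monX !mulrA -exprS.
Qed.

Lemma bi_const c : bi F = c%:P%:P -> F = c *: 'X_2%:R ^+ m.
Proof.
have Zm : 'X_2%:R ^+ m \is [in K[3], m.-homog].
  by rewrite -[m in m.-homog]mul1n dhomogMn // dhomogX /= mdeg1.
move=> Fc; apply: (bi_inj Fm); first by rewrite dhomogZ.
rewrite Fc /bi mmapZ rmorphXn /=.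
by have [_ _ ->] := ev_X (polyC \o @polyC K) 'X 'X%:P 1; rewrite expr1n mulr1.
Qed.

End Coefficients.

(** Under (X, Y, Z) -> (TX, TY, TZ) the form F becomes F T^m. Valuation and degree in T then force
    each factor to become a constant times a power of T. *)
Lemma homog_factor m F A B : F != 0 -> F \is m.-homog -> F = A * B ->
  exists k, A \is k.-homog.
Proof.
move=> F0 Fm FAB.
pose j : {rmorphism K -> {poly {mpoly K[3]}}} := polyC \o @mpolyC 3 K.
pose h G := ev j ('X * ('X_0)%:P) ('X * ('X_1)%:P) ('X * ('X_2%:R)%:P) G.
have e1 (G : {mpoly K[3]}) : horner_eval 1 ('X * G%:P) = G.
  by rewrite horner_evalE hornerM hornerX hornerC mul1r.
have h1 G : (h G).[1] = G.
  rewrite -[LHS](horner_evalE 1) -[RHS]ev_id.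
  apply: (ev_comp (g := horner_eval 1)); rewrite /= ?e1 // => c.
  by rewrite /= horner_evalE hornerC.
have hF : h F = F%:P * 'X^m.
  rewrite /h (ev_homog Fm) mulrC; congr (_ * _).
  by rewrite -[in RHS](ev_id F); apply/esym; apply: (ev_comp (g := polyC)).
have hAB : h A * h B = F%:P * 'X^m by rewrite -hF FAB /h rmorphM.
have AB0 : h A * h B != 0 by rewrite hAB mulf_neq0 ?polyC_eq0 // -size_poly_eq0 size_polyXn.
move: AB0; rewrite mulf_eq0 => /norP[A0 B0].
have [k [r r0 rA]] := poly_valuation A0; have [l [s s0 sB]] := poly_valuation B0.
have rs0 : (r * s)`_0 != 0 by rewrite coef0M mulf_neq0.
have E : r * s * 'X^(k + l) = F%:P * 'X^m by rewrite -hAB rA sB exprD; ring.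
have klm : (k + l)%N = m.
  by apply/eqP; rewrite eqn_leq (poly_valuation_le rs0 (esym E)) (poly_valuation_le _ E) // coefC.
have rsF : r * s = F%:P.
  by apply: (mulIf (x := 'X^m)); rewrite ?monic_neq0 ?monicXn // -E klm.
(* The product [r * s] has degree 0 in T and its coefficients lie in a domain, so [r] has degree 0
   as well. *)
have [a rE] : exists a, r = a%:P.
  exists (r`_0); apply: size1_polyC; have := congr1 (size : {poly _} -> nat) rsF.
  have rn0 : r != 0 by apply: contraNneq r0 => ->; rewrite coef0.
  have sn0 : s != 0 by apply: contraNneq s0 => ->; rewrite coef0.
  rewrite size_mul // size_polyC F0 => rs1.
  move: rn0 sn0 rs1; rewrite -!size_poly_gt0; case: (size r) (size s) => [|[|u]] [|v] //=.
  by rewrite addnS !addSn.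
have aA : a = A by rewrite -(h1 A) rA rE hornerM hornerC hornerXn expr1n mulr1.
exists k; apply/dhomogP => mo moA; apply/eqP.
have hX n : mmap1 (tnth [tuple 'X * ('X_0)%:P; 'X * ('X_1)%:P; 'X * ('X_2%:R)%:P]) n
    = ('X_[n])%:P * 'X^(mdeg n) :> {poly {mpoly K[3]}}.
  rewrite -(mmap1_eq _ (tnth3P (f := fun k => 'X * ('X_k)%:P) erefl erefl erefl)).
  rewrite /mmap1 (eq_bigr (fun k => ('X_k ^+ n k)%:P * 'X^(n k))) => [|e _].
    by rewrite big_split -rmorph_prod -mpolyXE_id -expr_sum mdegE.
  by rewrite mulrC exprMn rmorphXn.
(* The coefficient of T^d in [h A] is the homogeneous part of A of degree d. *)
have hE d : (h A)`_d@_mo = A@_mo *+ (mdeg mo == d).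
  rewrite /h /mmap coef_sum raddf_sum (bigD1_seq mo) ?msupp_uniq //= big1_seq => [|n /andP[nm _]].
    by rewrite hX mulrA -polyCM coefCM coefXn mulr_natr addr0 raddfMn /= mcoeffCM mcoeffX eqxx mulr1 eq_sym.
  rewrite hX mulrA -polyCM coefCM coefXn mulr_natr raddfMn /= mcoeffCM mcoeffX.
  by rewrite (negPf nm) mulr0 mul0rn.
have := hE (mdeg mo); rewrite rA rE aA eqxx coefCM coefXn mulr1n.
case: eqP => // _ /eqP; rewrite mulr0 mcoeff0 eq_sym -[_ == 0]negbK -mcoeff_msupp.
by rewrite moA.
Qed.
End HomogeneousForms.

(** * Compatibility of the Dickson forms with ring morphisms *)

Section MorphismForms.
Variables (R S : comNzRingType) (g : {rmorphism R -> S}) (q : nat) (x y z : R).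

Lemma rmorph_dV : g (dV q y z) = dV q (g y) (g z).
Proof. by rewrite /dV rmorphB rmorphM !rmorphXn. Qed.

Lemma rmorph_dD : g (dD q y z) = dD q (g y) (g z).
Proof. by rewrite /dD rmorphD !rmorphXn rmorph_dV. Qed.

Lemma rmorph_dM : g (dM q y z) = dM q (g y) (g z).
Proof. by rewrite /dM rmorphXn rmorphM rmorph_dV. Qed.

Lemma rmorph_dW : g (dW q x y z) = dW q (g x) (g y) (g z).
Proof. by rewrite /dW rmorphD rmorphB !rmorphM rmorph_dD rmorph_dM !rmorphXn. Qed.

Lemma rmorph_dC2 : g (dC2 q x y z) = dC2 q (g x) (g y) (g z).
Proof. by rewrite /dC2 rmorphD !rmorphXn rmorph_dW rmorph_dD. Qed.

Lemma rmorph_dC1 : g (dC1 q x y z) = dC1 q (g x) (g y) (g z).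
Proof. by rewrite /dC1 rmorphD rmorphM rmorphXn rmorph_dW rmorph_dD rmorphXn rmorph_dM. Qed.

End MorphismForms.

(** P - P(0) vanishes on the whole of [s], hence is divisible by W; the quotient is again invariant
    and of smaller degree, so induction applies. *)
Lemma translation_invariant (R : idomainType) (s : seq R) (W P : {poly R}) :
  uniq s -> W \is monic -> size W = (size s).+1 -> W`_0 = 0 -> 0 \in s ->
  {in s, forall l, W \Po ('X + l%:P) = W} ->
  {in s, forall l, P \Po ('X + l%:P) = P} ->
  exists Q, P = Q \Po W.
Proof.
move=> us Wm sW W0 s0 Winv.
have rootT (U : {poly R}) l : U \Po ('X + l%:P) = U -> U.[l] = U.[0].
  by move=> {2}<-; rewrite horner_comp !hornerE.
elim: {P}(size P) {-2}P (leqnn (size P)) => [|n IH] P sP Pinv.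
  by exists 0; rewrite comp_poly0; apply/eqP; rewrite -size_poly_leq0.
have [rP|rP] := leqP (size P) 1.
  by exists P; rewrite (size1_polyC rP) comp_polyC.
pose c := P.[0]; pose A := Pdiv.CommonRing.rdivp (P - c%:P) W.
have PE : P = A * W + c%:P.
  apply/eqP; rewrite -subr_eq; apply/eqP.
  have dE := Pdiv.RingMonic.rdivp_eq Wm (P - c%:P); rewrite [LHS]dE -/A.
  set r := Pdiv.CommonRing.rmodp _ _ in dE *.
  (* A nonzero remainder would have degree below the length of [s], yet it vanishes on [s]: there P
     takes the value P(0) and W the value 0. *)
  suff -> : r = 0 by rewrite addr0.
  apply/eqP; apply: contraT => r0.
  have sr : (size r < size W)%N by apply: Pdiv.CommonRing.ltn_rmodpN0; exact: monic_neq0.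
  suff rs : all (root r) s by have := max_poly_roots r0 rs us; rewrite ltnNge -ltnS -sW sr.
  apply/allP => l ls; rewrite rootE; have /(congr1 (horner^~ l)) := dE.
  have Wl : W.[l] = 0 by rewrite (rootT _ _ (Winv _ ls)) horner_coef0.
  by rewrite !hornerE Wl (rootT _ _ (Pinv _ ls)) subrr mulr0 add0r => <-.
have W0n := monic_neq0 Wm.
have A0 : A != 0 by apply: contraTneq rP => A0; rewrite PE A0 mul0r add0r -leqNgt size_polyC_leq1.
have W1 : (1 < size W)%N by rewrite sW; case: (s) s0.
have [||Q QE] := IH A.
- have := congr1 (size : {poly R} -> nat) PE.
  have sAW : size (A * W) = (size A + size s)%N by rewrite size_mul // sW addnS.
  have A1 : (0 < size A)%N by rewrite size_poly_gt0.
  rewrite sW ltnS in W1; rewrite size_polyDl; first last.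
    by rewrite sAW (leq_ltn_trans (size_polyC_leq1 c)) // (leq_add A1 W1).
  by rewrite sAW => sPE; rewrite -ltnS (leq_trans _ sP) // sPE -addn1 leq_add2l.
- move=> l ls; apply: (mulIf W0n); apply: (addIr c%:P).
  by rewrite -{1}(Winv l ls) -{1}(comp_polyC c ('X + l%:P)) -comp_polyM -comp_polyD -PE Pinv.
exists (Q * 'X + c%:P); rewrite comp_polyD comp_polyM comp_polyX comp_polyC -QE //.
Qed.

(** * Translations by F_q-linear forms *)

Section FiniteSubfield.
Variables (K : closedFieldType) (p q : nat).
Hypothesis hq : alg_closure_of_Fq K p q.

Lemma q_gt1 : (1 < q)%N.
Proof.
by case: hq => pp _ [k [k0 ->]] _; rewrite -(exp1n k) ltn_exp2r // prime_gt1.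
Qed.

Lemma q_gt0 : (0 < q)%N. Proof. exact: ltnW q_gt1. Qed.

Lemma predq_gt0 : (0 < q.-1)%N.
Proof. by case: q q_gt1 => [|[]]. Qed.

Lemma frob_alg (S : comNzRingType) (i : {rmorphism K -> S}) :
  {morph (fun x : S => x ^+ q) : x y / x + y}.
Proof.
case: hq => pp pK [k [k0 ->]] _ x y; apply: exprDn_pchar.
rewrite pnatX (pnatE _ pp); apply/orP; left; exact: (rmorph_pchar i).
Qed.

Lemma pchar_q : q%:R = 0 :> K.
Proof.
case: hq => pp pK [[|k] [k0 ->]] _ //; by rewrite expnS natrM (pcharf0 pK) mul0r.
Qed.

(** As q - 1 = -1 is nonzero in K, the polynomial X^(q-1) - 1 has q - 1 distinct roots, and a finite
    group of roots of unity is cyclic. *)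
Lemma prim_root_ex : exists z : K, q.-1.-primitive_root z.
Proof.
have q1 := predq_gt0.
have q1r : q.-1%:R = -1 :> K.
  apply/eqP; rewrite -subr_eq0 opprK natr1 (prednK q_gt0) pchar_q //.
have sep : separable_poly ('X^(q.-1) - 1 : {poly K}).
  by apply: separable_Xn_sub_1; rewrite q1r oppr_eq0 oner_eq0.
have [r rE] := closed_field_poly_normal ('X^(q.-1) - 1 : {poly K}).
have lc : lead_coef ('X^(q.-1) - 1 : {poly K}) = 1.
  by rewrite -polyC1 lead_coefXnsubC.
rewrite lc scale1r in rE; rewrite rE separable_prod_XsubC in sep.
have sr : size r = q.-1.
  have := congr1 (size : {poly K} -> nat) rE.
  by rewrite -polyC1 size_XnsubC // size_prod_XsubC => -[].
have rr : all q.-1.-unity_root r.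
  by apply/allP => z zr; rewrite /root_of_unity rE root_prod_XsubC.
by have /hasP[z _ zp] := has_prim_root q1 rr sep (eq_leq (esym sr)); exists z.
Qed.

(** F_q is listed as 0 and the powers of a primitive root of unity of order q - 1. *)
Lemma Fq_seq : exists s : seq K,
  [/\ uniq s, size s = q, 0 \in s & {in s, forall x, x ^+ q = x}].
Proof.
have [z zp] := prim_root_ex; have q1 := predq_gt0.
have zE i : (z ^+ i) ^+ q = z ^+ i.
  by rewrite -(prednK q_gt0) exprS -exprM mulnC exprM (prim_expr_order zp) expr1n mulr1.
have z0 : z != 0.
  by apply: contra_eq_neq (prim_expr_order zp) => ->; rewrite expr0n gtn_eqF // eq_sym oner_neq0.
exists (0 :: [seq z ^+ i | i <- iota 0 q.-1]); split.
- rewrite /= map_inj_in_uniq ?iota_uniq ?andbT.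
    by apply/mapP => -[i _ /eqP]; rewrite eq_sym (negPf (expf_neq0 _ z0)).
  move=> i j; rewrite !mem_iota !add0n /= => iq jq /eqP.
  by rewrite (eq_prim_root_expr zp) !modn_small // => /eqP.
- by rewrite /= size_map size_iota (prednK q_gt0).
- by rewrite mem_head.
- move=> x; rewrite inE => /predU1P[->|/mapP[i _ ->]] //.
  by rewrite expr0n gtn_eqF // q_gt0.
Qed.

Definition bW : {poly {poly K}} := dW q 'X 'X%:P 1.

Lemma bWE : bW = 'X^(q ^ 2) - ((dD q 'X 1)%:P * 'X^q - (dM q 'X 1)%:P * 'X).
Proof.
by rewrite /bW /dW (rmorph_dD polyC) (rmorph_dM polyC) rmorph1 opprB addrA addrAC.
Qed.

Lemma size_bW_tail :
  (size ((dD q 'X 1)%:P * 'X^q - (dM q 'X 1)%:P * 'X : {poly {poly K}})%R < (q ^ 2).+1)%N.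
Proof.
have q1 := q_gt1; apply: leq_ltn_trans (size_polyD _ _) _; rewrite size_polyN gtn_max !ltnS.
have qq : (q < q ^ 2)%N by nia.
have ss (c : {poly K}) k : (size (c%:P * 'X^k : {poly {poly K}})%R <= k.+1)%N.
  by rewrite mul_polyC (leq_trans (size_scale_leq _ _)) // size_polyXn.
rewrite (leq_trans (ss _ q)) //; by rewrite (leq_trans (ss _ 1)) // (leq_trans q1) // ltnW.
Qed.

Lemma size_bW : size bW = (q ^ 2).+1.
Proof. by rewrite bWE size_polyDl ?size_polyN ?size_polyXn ?size_bW_tail. Qed.

Lemma monic_bW : bW \is monic.
Proof.
by rewrite bWE monicE lead_coefDl ?size_polyN ?size_polyXn ?size_bW_tail ?lead_coefXn.
Qed.

Lemma coef0_bW : bW`_0 = 0.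
Proof.
rewrite -horner_coef0 bWE !hornerE !expr0n expn_eq0.
by rewrite gtn_eqF ?q_gt0 //= ?mulr0 ?subrr ?subr0 ?oppr0 ?addr0.
Qed.

Lemma dW_Fq_line (S : comNzRingType) (i : {rmorphism K -> S}) a b y z :
  a ^+ q = a -> b ^+ q = b -> dW q (i a * y + i b * z) y z = 0.
Proof.
move=> aq bq; have q0 := q_gt0; have fr := frob_alg i.
rewrite (dW_add fr) !dW_scale; try by rewrite -rmorphXn ?aq ?bq.
by rewrite (dW_y q0 fr) (dW_z q0) !mulr0 addr0.
Qed.

(** The q^2 translations by aY + b are exactly as many as the degree of the monic polynomial [bW],
    which they leave invariant. *)
Lemma bi_translation F :
  (forall a b : K, a ^+ q = a -> b ^+ q = b ->
     bi F \Po ('X + (a *: 'X + b%:P)%:P) = bi F) ->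
  exists Q, bi F = Q \Po bW.
Proof.
move=> Finv; have [s [us ss s0 sq]] := Fq_seq.
have fr := frob_alg (polyC \o @polyC K : {rmorphism K -> {poly {poly K}}}).
pose l (ab : K * K) : {poly K} := ab.1 *: 'X + ab.2%:P.
have linj : injective l.
  move=> [a b] [c d] /= E; have := congr1 (fun u : {poly K} => (u`_0, u`_1)) E.
  by rewrite /l /= !coefD !coefZ !coefX !coefC /= !mulr0 !add0r !mulr1 !addr0 => -[-> ->].
apply: (@translation_invariant _ [seq l ab | ab <- [seq (a, b) | a <- s, b <- s]]).
- by rewrite map_inj_uniq // allpairs_uniq // => -[? ?] [? ?].
- exact: monic_bW.
- by rewrite size_map size_allpairs ss size_bW mulnn.
- exact: coef0_bW.
- apply/mapP; exists (0, 0); last by rewrite /l scale0r add0r.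
  by apply/allpairsP; exists (0, 0).
- move=> _ /mapP[_ /allpairsP[[a b] /= [/sq aq /sq bq ->]] ->].
  rewrite /bW (rmorph_dW (comp_poly _)) /= comp_polyX comp_polyC rmorph1 (dW_add fr).
  rewrite -[RHS]addr0; congr (_ + _).
  have := dW_Fq_line (polyC \o @polyC K) 'X%:P 1 aq bq.
  by rewrite /= mulr1 -polyCM mul_polyC -polyCD.
- by move=> _ /mapP[_ /allpairsP[[a b] /= [/sq aq /sq bq ->]] ->]; apply: Finv.
Qed.

End FiniteSubfield.

(** * The two Dickson invariants as ternary forms *)

Section Invariants.
Variables (K : closedFieldType) (p q : nat).
Hypothesis hq : alg_closure_of_Fq K p q.

Definition C2 : {mpoly K[3]} := dC2 q 'X_0 'X_1 'X_2%:R.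
Definition C1 : {mpoly K[3]} := dC1 q 'X_0 'X_1 'X_2%:R.

Lemma ev_C2 (S : comNzRingType) (i : {rmorphism K -> S}) x y z :
  ev i x y z C2 = dC2 q x y z.
Proof. by have [X0 X1 X2] := ev_X i x y z; rewrite (rmorph_dC2 (mmap i _)) /= X0 X1 X2. Qed.

Lemma ev_C1 (S : comNzRingType) (i : {rmorphism K -> S}) x y z :
  ev i x y z C1 = dC1 q x y z.
Proof. by have [X0 X1 X2] := ev_X i x y z; rewrite (rmorph_dC1 (mmap i _)) /= X0 X1 X2. Qed.

Let X_homog (k : 'I_3) : 'X_k \is [in K[3], 1.-homog].
Proof. by rewrite dhomogX /= mdeg1. Qed.

Let Xn_homog (k : 'I_3) n : 'X_k ^+ n \is [in K[3], n.-homog].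
Proof. by rewrite -[n in n.-homog]mul1n dhomogMn. Qed.

Let homogM (F G : {mpoly K[3]}) d e n : F \is d.-homog -> G \is e.-homog ->
  (d + e)%N = n -> F * G \is n.-homog.
Proof. by move=> Fd Ge <-; apply: dhomogM. Qed.

Let homogX (F : {mpoly K[3]}) d k n : F \is d.-homog -> (d * k)%N = n -> F ^+ k \is n.-homog.
Proof. by move=> Fd <-; apply: dhomogMn. Qed.

Let q1 := q_gt1 hq.
Let q0 := q_gt0 hq.

Let V_homog : dV q 'X_1 'X_2%:R \is [in K[3], q.-homog].
Proof. apply: rpredB; first exact: Xn_homog.
by apply: (homogM (X_homog _) (Xn_homog _ _)); rewrite add1n prednK. Qed.

Let D_homog : dD q 'X_1 'X_2%:R \is [in K[3], (q * q.-1).-homog].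
Proof. by apply: rpredD; [apply: (homogX V_homog) | apply: Xn_homog]. Qed.

Let M_homog : dM q 'X_1 'X_2%:R \is [in K[3], ((1 + q) * q.-1).-homog].
Proof. exact: (homogX (homogM (X_homog _) V_homog erefl)). Qed.

Let W_homog : dW q 'X_0 'X_1 'X_2%:R \is [in K[3], (q ^ 2).-homog].
Proof.
apply: rpredD; first apply: rpredB.
- exact: Xn_homog.
- by apply: (homogM D_homog (Xn_homog _ _)); case: (q) q0 => // n _; rewrite /=; nia.
by apply: (homogM M_homog (X_homog _)); case: (q) q0 => // n _; rewrite /=; nia.
Qed.

Lemma C2_homog : C2 \is (q ^ 3 - q ^ 2)%N.-homog.
Proof.
by apply: rpredD; [apply: (homogX W_homog) | apply: (homogX D_homog)];
  case: (q) q0 => // n _; rewrite /= !expnS expn0; nia.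
Qed.

Lemma C1_homog : C1 \is (q ^ 3 - q)%N.-homog.
Proof.
by apply: rpredD; [apply: (homogM D_homog (homogX W_homog erefl)) | apply: (homogX M_homog)];
  case: (q) q0 => // n _; rewrite /= !expnS expn0; nia.
Qed.

(** In the chart Z = 1 it is (Y - Y^q) W, with W monic in X. *)
Lemma moore_neq0 : moore q (q ^ 2) 'X_0 'X_1 'X_2%:R != 0 :> {mpoly K[3]}.
Proof.
have frm := frob_alg hq (@mpolyC 3 K); rewrite (moore12 q0 frm).
apply/eqP => /(congr1 (@bi K)); rewrite /bi rmorph0 rmorphM /= rmorph_dW.
have [X0 X1 X2] := ev_X (polyC \o @polyC K) 'X 'X%:P 1.
rewrite rmorphB !rmorphM !rmorphXn /= X0 X1 X2 expr1n !mulr1 -rmorphXn -rmorphB.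
apply/eqP; rewrite mulf_neq0 ?(monic_neq0 (monic_bW hq)) // polyC_eq0.
apply/eqP => /(congr1 (fun u : {poly K} => u`_1)).
by rewrite coefB coefX coefXn coef0 /= ltn_eqF // subr0 => /eqP; rewrite oner_eq0.
Qed.

Lemma det_act_neq0 (M : 'M[K]_3) : \det M != 0 ->
  \det (map_mx (@mpolyC 3 K) M) * moore q (q ^ 2) 'X_0 'X_1 'X_2%:R != 0.
Proof. by move=> dM; rewrite det_map_mx mulf_neq0 ?moore_neq0 // mpolyC_eq0. Qed.

(** Numerator and denominator of the quotient of Moore determinants are both multiplied by det M,
    which cancels. *)
Lemma act_C2 M : GL3q q M -> act M C2 = C2.
Proof.
move=> [Mq dM]; have frm := frob_alg hq (@mpolyC 3 K).
apply: (mulIf (det_act_neq0 dM)).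
have Mq' i j : map_mx (@mpolyC 3 K) M i j ^+ q = map_mx (@mpolyC 3 K) M i j.
  by rewrite mxE -rmorphXn Mq.
have L := moore_lin frm _ _ 'X_0 'X_1 'X_2%:R Mq'.
rewrite -{1}(L 1 2) mulrCA (dC2_moore q0 frm) -(L 1 3).
by rewrite !mxE actE ev_C2 (dC2_moore q0 frm).
Qed.

Lemma act_C1 M : GL3q q M -> act M C1 = C1.
Proof.
move=> [Mq dM]; have frm := frob_alg hq (@mpolyC 3 K).
apply: (mulIf (det_act_neq0 dM)).
have Mq' i j : map_mx (@mpolyC 3 K) M i j ^+ q = map_mx (@mpolyC 3 K) M i j.
  by rewrite mxE -rmorphXn Mq.
have L := moore_lin frm _ _ 'X_0 'X_1 'X_2%:R Mq'.
rewrite -{1}(L 1 2) mulrCA (dC1_moore q0 frm) -(L 2 3).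
by rewrite !mxE actE ev_C1 (dC1_moore q0 frm).
Qed.

Lemma dehom_C2 : dehom C2 * DGZ_den K q = DGZ_num K q.
Proof.
have frm := frob_alg hq (@mpolyC 2 K).
have mooreE a b : moore a b 'X_0 'X_1 1 = 
  ('X_0 ^+ a - 'X_0) * ('X_1 ^+ b - 'X_1) - ('X_1 ^+ a - 'X_1) * ('X_0 ^+ b - 'X_0) :> {mpoly K[2]}.
  by rewrite /moore !expr1n; ring.
(* The DGZ numerator and denominator are Moore determinants at (X, Y, 1) with the same sign change,
   which disappears in the quotient. *)
have dE : DGZ_den K q = - moore q (q ^ 2) 'X_0 'X_1 1 by rewrite mooreE /DGZ_den; ring.
have nE : DGZ_num K q = - moore q (q ^ 3) 'X_0 'X_1 1 by rewrite mooreE /DGZ_num; ring.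
by rewrite dehomE ev_C2 dE nE mulrN (dC2_moore q0 frm).
Qed.

Lemma PGL_invariant_C2 : PGL3q_invariant q C2.
Proof. by move=> M GM; exists 1; rewrite oner_neq0 scale1r act_C2. Qed.

Lemma PGL_invariant_C1 : PGL3q_invariant q C1.
Proof. by move=> M GM; exists 1; rewrite oner_neq0 scale1r act_C1. Qed.

End Invariants.

(** * Semi-invariant forms *)

Section SemiInvariants.
Variables (K : closedFieldType) (p q : nat).
Hypothesis hq : alg_closure_of_Fq K p q.
Let q1 := q_gt1 hq.
Let q0 := q_gt0 hq.

Lemma GL3q_mx3 (a b c d e f g h k : K) :
  all (fun u => u ^+ q == u) [:: a; b; c; d; e; f; g; h; k] ->
  a * (e * k - f * h) - b * (d * k - f * g) + c * (d * h - e * g) != 0 ->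
  GL3q q (mx3 a b c d e f g h k).
Proof.
move=> /allP fixed dM; split; last by rewrite det3E !mxE.
move=> i j; apply/eqP; apply: fixed; rewrite mxE.
by case: i j => [[|[|[|//]]] Hi] [[|[|[|//]]] Hj]; rewrite /= !inE eqxx ?orbT.
Qed.

(** Turns invariance under one matrix into a functional equation with a single scalar [t], valid
    over every ring receiving K; [t] can be computed at a convenient place and used elsewhere. *)
Lemma ev_semi_invariant F (a b c d e f g h k : K) : PGL3q_invariant q F ->
  all (fun u => u ^+ q == u) [:: a; b; c; d; e; f; g; h; k] ->
  a * (e * k - f * h) - b * (d * k - f * g) + c * (d * h - e * g) != 0 ->
  exists2 t : K, t != 0 &
  forall (S : comNzRingType) (i : {rmorphism K -> S}) x y z,
  ev i (i a * x + i b * y + i c * z) (i d * x + i e * y + i f * z)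
    (i g * x + i h * y + i k * z) F = i t * ev i x y z F.
Proof.
move=> Finv fixed dM; have [t [t0 tE]] := Finv _ (GL3q_mx3 fixed dM).
by exists t => // S i x y z; rewrite -ev_act_mx3 tE mmapZ.
Qed.

Lemma zeta_ex : exists z : K, [/\ q.-1.-primitive_root z, z != 0 & z ^+ q = z].
Proof.
have [z zp] := prim_root_ex hq; exists z; split=> //; last first.
  by rewrite -(prednK q0) exprS (prim_expr_order zp) mulr1.
apply: contra_eq_neq (prim_expr_order zp) => ->.
by rewrite expr0n (gtn_eqF (predq_gt0 hq)) eq_sym oner_neq0.
Qed.

Lemma frob_fix0 : (0 : K) ^+ q == 0. Proof. by rewrite expr0n gtn_eqF. Qed.
Lemma frob_fix1 : (1 : K) ^+ q == 1. Proof. by rewrite expr1n. Qed.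

Section Form.
Variable F : {mpoly K[3]}.
Hypothesis Finv : PGL3q_invariant q F.

Lemma ev_swap : 
  [/\ exists2 t : K, t != 0 & forall (S : comNzRingType) (i : {rmorphism K -> S}) x y z,
        ev i y x z F = i t * ev i x y z F,
      exists2 t : K, t != 0 & forall (S : comNzRingType) (i : {rmorphism K -> S}) x y z,
        ev i x z y F = i t * ev i x y z F
    & exists2 t : K, t != 0 & forall (S : comNzRingType) (i : {rmorphism K -> S}) x y z,
        ev i z y x F = i t * ev i x y z F].
Proof.
split.
- have [||t t0 tE] := @ev_semi_invariant F 0 1 0 1 0 0 0 0 1 Finv.
  + by rewrite /= !frob_fix0 !frob_fix1.
  + by rewrite (_ : _ + _ = -1); [rewrite oppr_eq0 oner_neq0 | ring].
  exists t => // S i x y z; rewrite -tE; congr (mmap _ (tnth [tuple _; _; _]) _); rewrite !(rmorph0, rmorph1); ring.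
- have [||t t0 tE] := @ev_semi_invariant F 1 0 0 0 0 1 0 1 0 Finv.
  + by rewrite /= !frob_fix0 !frob_fix1.
  + by rewrite (_ : _ + _ = -1); [rewrite oppr_eq0 oner_neq0 | ring].
  exists t => // S i x y z; rewrite -tE; congr (mmap _ (tnth [tuple _; _; _]) _); rewrite !(rmorph0, rmorph1); ring.
- have [||t t0 tE] := @ev_semi_invariant F 0 0 1 0 1 0 1 0 0 Finv.
  + by rewrite /= !frob_fix0 !frob_fix1.
  + by rewrite (_ : _ + _ = -1); [rewrite oppr_eq0 oner_neq0 | ring].
  exists t => // S i x y z; rewrite -tE; congr (mmap _ (tnth [tuple _; _; _]) _); rewrite !(rmorph0, rmorph1); ring.
Qed.

Lemma bi_shift (a b : K) : bi F \Po ('X + (a *: 'X + b%:P)%:P) =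
  ev (polyC \o @polyC K) ('X + a%:P%:P * 'X%:P + b%:P%:P * 1) 'X%:P 1 F.
Proof.
apply: (ev_comp (g := comp_poly _)) => [c|||] /=.
- by rewrite comp_polyC.
- by rewrite comp_polyX mulr1 -polyCM mul_polyC polyCD addrA.
- by rewrite comp_polyC.
- by rewrite -polyC1 comp_polyC.
Qed.

(** The scalar is 1 because a translation of X preserves the leading coefficient in X. *)
Lemma ev_elation a b : bi F != 0 -> a ^+ q = a -> b ^+ q = b ->
  forall (S : comNzRingType) (i : {rmorphism K -> S}) x y z,
  ev i (x + i a * y + i b * z) y z F = ev i x y z F.
Proof.
move=> bF0 aq bq.
have [||t t0 tE] := @ev_semi_invariant F 1 a b 0 1 0 0 0 1 Finv.
- by rewrite /= !frob_fix0 !frob_fix1 aq bq !eqxx.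
- by rewrite (_ : _ + _ = 1); [rewrite oner_neq0 | ring].
have {}tE (S : comNzRingType) (i : {rmorphism K -> S}) x y z :
    ev i (x + i a * y + i b * z) y z F = i t * ev i x y z F.
  rewrite -tE; congr (mmap _ (tnth [tuple _; _; _]) _); rewrite !(rmorph0, rmorph1); ring.
suff t1 : t = 1 by move=> S i x y z; rewrite tE t1 rmorph1 mul1r.
have := congr1 lead_coef (bi_shift a b); rewrite (tE _ (polyC \o @polyC K)) -/(bi F).
rewrite lead_coef_comp ?size_XaddC // lead_coefXaddC expr1n mulr1 lead_coefM lead_coefC.
rewrite -[LHS]mul1r => /mulIf; rewrite lead_coef_eq0 => /(_ bF0) /esym /polyC_inj; exact.
Qed.

End Form.

End SemiInvariants.

Lemma coef_comp_scale (R : comNzRingType) (Q : {poly R}) c j :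
  (Q \Po (c%:P * 'X))`_j = c ^+ j * Q`_j.
Proof.
rewrite coef_comp_poly.
have E i : ((c%:P * 'X) ^+ i)`_j = c ^+ i * (j == i)%:R.
  by rewrite exprMn -rmorphXn coefCM coefXn.
have [jQ|Qj] := ltnP j (size Q).
  rewrite (bigD1 (Ordinal jQ)) //= big1 => [|i]; first by rewrite E eqxx mulr1 addr0 mulrC.
  by rewrite -val_eqE /= E eq_sym => /negPf ->; rewrite !mulr0.
rewrite nth_default // mulr0 big1 // => i _; rewrite E gtn_eqF ?mulr0 //.
exact: leq_trans Qj.
Qed.

(** Comparing coefficients gives c^j = 1 at every exponent j that occurs. *)
Lemma scale_invariant_coef (R : idomainType) (c : R) n (Q : {poly R}) j :
  (forall k, c ^+ k = 1 -> (n %| k)%N) -> Q \Po (c%:P * 'X) = Q ->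
  Q`_j != 0 -> (n %| j)%N.
Proof.
move=> cn Qc Qj; apply: cn; apply: (mulIf Qj).
by rewrite -coef_comp_scale Qc mul1r.
Qed.

Lemma comp_poly_inj (R : idomainType) (W P Q : {poly R}) :
  (1 < size W)%N -> P \Po W = Q \Po W -> P = Q.
Proof.
move=> sW /eqP; rewrite -subr_eq0 -comp_polyB comp_poly_eq0 // subr_eq0.
by move=> /eqP.
Qed.

(** * Divisibility of the degree and restriction to the line X = 0 *)

Section LowerBound.
Variables (K : closedFieldType) (p q : nat).
Hypothesis hq : alg_closure_of_Fq K p q.
Let q1 := q_gt1 hq.
Let q0 := q_gt0 hq.
Let qp := predq_gt0 hq.

(** The affine part is Q(W) of degree m in X, so q^2 divides m; scaling by a primitive root of unity
    z gives z^m = 1, so q - 1 divides m. The hypotheses are stated separately because the lemma also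
    serves for factors of the DGZ form, which are not known to be invariant under all of
    PGL(3,q). *)
Lemma degree_dvd m (F : {mpoly K[3]}) : F \is m.-homog ->
  (forall a b : K, a ^+ q = a -> b ^+ q = b ->
     bi F \Po ('X + (a *: 'X + b%:P)%:P) = bi F) ->
  (forall z : K, z != 0 -> z ^+ q = z -> ev idfun z 0 0 F = ev idfun 1 0 0 F) ->
  ev idfun 1 0 0 F != 0 -> (q ^ 2 * q.-1 %| m)%N.
Proof.
move=> Fm Fe Ft F1; have [Q QE] := bi_translation hq Fe.
have sF : size (bi F) = m.+1.
  apply/eqP; rewrite eqn_leq size_bi //= ltnNge; apply/negP => sF.
  have /eqP := coef_bi_top Fm; rewrite nth_default // eq_sym polyC_eq0.
  by rewrite (negPf F1).
rewrite Gauss_dvd; last first.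
  by rewrite coprime_sym coprimeXr // -{2}(prednK q0) coprimenS.
apply/andP; split.
  have := size_comp_poly Q (bW K q); rewrite -QE sF (size_bW hq) /= => ->.
  exact: dvdn_mull.
have [z [zp z0 zq]] := zeta_ex hq; rewrite (prim_order_dvd zp).
apply/eqP; apply: (mulIf F1); rewrite mul1r -(ev_homog Fm idfun z 1 0 0) !mulr0 mulr1.
exact: Ft.
Qed.

Section Form.
Variables (m : nat) (F : {mpoly K[3]}).
Hypotheses (Fm : F \is m.-homog) (Finv : PGL3q_invariant q F).
Local Notation phi := (ev (@polyC K) 0 'X 1 F).
Hypothesis phi0 : phi != 0.

Lemma bi_neq0 : bi F != 0.
Proof. by apply: contraNneq phi0 => bF; rewrite -bi_coef0 bF coef0. Qed.

(** The scalar is 1 because diag(z, 1, 1) fixes the line X = 0 pointwise and F is not zero on that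
    line. *)
Lemma ev_torus z : z != 0 -> z ^+ q = z ->
  forall (S : comNzRingType) (i : {rmorphism K -> S}) x y w,
  ev i (i z * x) y w F = ev i x y w F.
Proof.
move=> z0 zq.
have [||t t0 tE] := @ev_semi_invariant K q F z 0 0 0 1 0 0 0 1 Finv.
- by rewrite /= !(frob_fix0 hq) !frob_fix1 zq !eqxx.
- by rewrite (_ : _ + _ = z) //; ring.
have {}tE (S : comNzRingType) (i : {rmorphism K -> S}) x y w :
    ev i (i z * x) y w F = i t * ev i x y w F.
  rewrite -tE; congr (mmap _ (tnth [tuple _; _; _]) _); rewrite !(rmorph0, rmorph1); ring.
suff t1 : t = 1 by move=> S i x y w; rewrite tE t1 rmorph1 mul1r.
have /eqP := tE _ (@polyC K) 0 'X 1; rewrite mulr0 -[X in X == _]mul1r => /eqP.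
by move=> /(mulIf phi0) /esym /polyC_inj.
Qed.

Lemma ev_translation a b : a ^+ q = a -> b ^+ q = b ->
  forall (S : comNzRingType) (i : {rmorphism K -> S}) x y z,
  ev i (x + i a * y + i b * z) y z F = ev i x y z F.
Proof. exact: (ev_elation hq Finv bi_neq0). Qed.

Lemma bi_elation a b : a ^+ q = a -> b ^+ q = b ->
  bi F \Po ('X + (a *: 'X + b%:P)%:P) = bi F.
Proof.
by move=> aq bq; rewrite bi_shift; apply: (ev_translation aq bq (polyC \o @polyC K)).
Qed.

(** Exchange X and Y in bi F = Q(W) and put Y = 0: there V = 0, D = 1, M = 0, and W becomes X^(q^2)
    - X^q. *)
Lemma ev_line_comp : exists R : {poly K}, phi = R \Po ('X^q - 'X) ^+ q.
Proof.
have [Q QE] := bi_translation hq bi_elation.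
have [[t t0 tE] _ _] := ev_swap hq Finv.
have := tE _ (polyC \o @polyC K) 'X 'X%:P 1; rewrite -/(bi F) QE.
move=> /(congr1 (map_poly (horner_eval 0))).
rewrite (ev_comp (g := map_poly (horner_eval 0)) (j := @polyC K)
  (x' := 0) (y' := 'X) (z' := 1)); first last.
- by rewrite rmorph1.
- by rewrite /= map_polyX.
- by rewrite /= map_polyC /= horner_evalE hornerX.
- by move=> c; rewrite /= map_polyC /= horner_evalE hornerC.
rewrite rmorphM /= map_polyC /= horner_evalE hornerC map_comp_poly.
rewrite (rmorph_dW (map_poly (horner_eval 0))) /= map_polyX map_polyC rmorph1 /= horner_evalE hornerX.
have -> : dW q 'X 0 1 = ('X^q - 'X) ^+ q :> {poly K}.
  have fr := frob_alg hq (@polyC K).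
  rewrite (frobB q0 fr) -exprq2 /dW /dM /dD /dV expr0n !expr1n gtn_eqF // !mul0r subrr mulr0.
  by rewrite !expr0n gtn_eqF // add0r mul1r mul0r addr0.
by move=> ->; exists (t%:P * map_poly (horner_eval 0) Q); rewrite comp_polyM comp_polyC.
Qed.

(** The exchange of X and Y carries this scaling of Y to the scaling of X in [ev_torus]. *)
Lemma phi_torus z : z != 0 -> z ^+ q = z -> phi \Po (z%:P * 'X) = phi.
Proof.
move=> z0 zq; have [[t t0 tE] _ _] := ev_swap hq Finv.
have -> : phi \Po (z%:P * 'X) = ev (@polyC K) 0 (z%:P * 'X) 1 F.
  apply: (ev_comp (g := comp_poly _)) => [c|||] /=.
  - by rewrite comp_polyC.
  - exact: comp_poly0.
  - by rewrite comp_polyX.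
  - by rewrite -polyC1 comp_polyC.
apply: (mulfI (x := t%:P)); first by rewrite polyC_eq0.
by rewrite -!tE ev_torus.
Qed.

Lemma coef_phi_sym j : (j <= m)%N -> phi`_j != 0 -> phi`_(m - j) != 0.
Proof.
move=> jm pj; have [_ [t t0 tE] _] := ev_swap hq Finv.
by rewrite -(coef_ev_line_rev Fm) // tE coefCM mulf_neq0.
Qed.

End Form.
End LowerBound.

(** The exponents that occur are multiples of n and at most n. *)
Lemma scale_invariant_binomial (R : idomainType) (c : R) n (Q : {poly R}) :
  (0 < n)%N -> (forall k, c ^+ k = 1 -> (n %| k)%N) -> Q \Po (c%:P * 'X) = Q ->
  (size Q <= n.+1)%N -> Q = (Q`_n)%:P * 'X^n + (Q`_0)%:P.
Proof.
move=> n0 cn Qc sQ; apply/polyP => j; rewrite coefD coefCM coefXn coefC.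
have [->|j0] := eqVneq j 0%N; first by rewrite (ltn_eqF n0) mulr0 add0r.
have [->|jn] := eqVneq j n; first by rewrite mulr1 addr0.
rewrite mulr0 addr0; apply/eqP; apply: contraT => Qj.
have dj := scale_invariant_coef cn Qc Qj.
have jn' : (j <= n)%N.
  by rewrite -ltnS (leq_trans _ sQ) // ltnNge; apply: contra Qj => /(nth_default 0) ->.
have := dvdn_leq _ dj; rewrite lt0n => /(_ j0) nj.
by rewrite eqn_leq jn' nj in jn.
Qed.

(** * The degree bound and uniqueness in degree q^3 - q^2 *)

Section Uniqueness.
Variables (K : closedFieldType) (p q : nat).
Hypothesis hq : alg_closure_of_Fq K p q.
Let q1 := q_gt1 hq.
Let q0 := q_gt0 hq.
Let qp := predq_gt0 hq.
Let fr := frob_alg hq (@polyC K).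

Local Notation U := (('X^q - 'X : {poly K}) ^+ q).

Let UE : U = 'X^(q ^ 2) - 'X^q.
Proof. by rewrite (frobB q0 fr) exprq2. Qed.

Let size_U : size U = (q ^ 2).+1.
Proof.
have qq : (q.+1 < (q ^ 2).+1)%N by rewrite ltnS -{1}(expn1 q) ltn_exp2l.
by rewrite UE size_polyDl ?size_polyN !size_polyXn.
Qed.

Let lead_U : lead_coef U = 1.
Proof.
have qq : (q.+1 < (q ^ 2).+1)%N by rewrite ltnS -{1}(expn1 q) ltn_exp2l.
by rewrite UE lead_coefDl ?size_polyN ?size_polyXn ?lead_coefXn.
Qed.

Let U_scale (z : K) : z ^+ q = z -> U \Po (z%:P * 'X) = (z%:P * 'X) \Po U.
Proof.
move=> zq; rewrite comp_polyM comp_polyC comp_polyX UE comp_polyB !comp_Xn_poly !exprMn.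
have zE : (z%:P : {poly K}) ^+ q = z%:P by rewrite -rmorphXn zq.
by rewrite exprq2 !zE; ring.
Qed.

Section Form.
Variables (m : nat) (F : {mpoly K[3]}).
Hypotheses (Fm : F \is m.-homog) (Finv : PGL3q_invariant q F).
Local Notation phi := (ev (@polyC K) 0 'X 1 F).
Hypothesis phi0 : phi != 0.

(** Let k be the order of R at 0, where phi = R(U). Then phi has order qk at 0 and degree at least
    q^2 k, and the symmetry between Y and Z bounds m below by the sum of the two. Moreover k is a
    positive multiple of q - 1. *)
Lemma degree_ge : ev idfun 1 0 0 F = 0 -> (q ^ 3 - q <= m)%N.
Proof.
move=> F1; have [R RE] := ev_line_comp hq Finv phi0.
have R0 : R != 0 by apply: contraNneq phi0 => R0; rewrite RE R0 comp_poly0.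
have [k [r r0 rE]] := poly_valuation R0.
pose s := (r \Po U) * (('X^(q.-1) - 1) ^+ q) ^+ k.
have phiE : phi = s * 'X^(q * k).
  have UX : U = ('X^(q.-1) - 1) ^+ q * 'X^q.
    by rewrite -exprMn mulrBl mul1r -exprSr prednK.
  by rewrite RE {1}rE comp_polyM comp_Xn_poly {2}UX exprMn -(exprM 'X) mulrA.
have s0 : s`_0 != 0.
  rewrite -horner_coef0 /s hornerM horner_comp !horner_exp !hornerE.
  have e0 : (0 : K) ^+ q.-1 = 0 by rewrite expr0n gtn_eqF.
  rewrite (frob0 _ q0) subrr (frob0 _ q0) e0 sub0r horner_coef0.
  by rewrite mulf_neq0 // !expf_neq0 // oppr_eq0 oner_neq0.
(* Otherwise phi(0) = F(0,0,1) would be nonzero, although it is proportional to F(1,0,0) = 0. *)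
have k0 : k != 0%N.
  apply: contraNneq s0 => k0.
  have -> : s = phi by rewrite phiE k0 muln0 expr0 mulr1.
  have [_ _ [t t0 tE]] := ev_swap hq Finv.
  by rewrite coef0_ev_line tE F1 mulr0.
have [z [zp z0 zq]] := zeta_ex hq.
have zdvd j : z ^+ j = 1 -> (q.-1 %| j)%N by move=> /eqP; rewrite -(prim_order_dvd zp).
have kq : (q.-1 <= k)%N.
  rewrite dvdn_leq ?lt0n // -(Gauss_dvdr k (_ : coprime q.-1 q)); last first.
    by rewrite -{2}(prednK q0) coprimenS.
  apply: (scale_invariant_coef zdvd (phi_torus hq Finv phi0 z0 zq)).
  by rewrite phiE coefMXn ltnn subnn.
pose N := (size phi).-1.
have NE : N = ((size R).-1 * q ^ 2)%N by rewrite /N RE size_comp_poly size_U.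
have phN : phi`_N != 0 by rewrite -lead_coefE lead_coef_eq0.
have Nm : (N <= m)%N by have := size_ev_line Fm; rewrite -[(N <= m)%N]ltnS /N prednK ?size_poly_gt0.
(* By symmetry the coefficient of index m - N is nonzero too, so m - N is at least the order qk of
   phi. *)
have := coef_phi_sym hq Fm Finv Nm phN; rewrite {1}phiE coefMXn.
case: ltnP => [_|mN _]; first by rewrite eqxx.
have sR : (k <= (size R).-1)%N.
  have rn0 : r != 0 by apply: contraNneq r0 => ->; rewrite coef0.
  rewrite rE size_Mmonic ?monicXn // size_polyXn addnS /=.
  by move: rn0; rewrite -size_poly_gt0; case: (size r) => // u _; rewrite addSn /= leq_addl.
have kN : (q.-1 * q ^ 2 <= N)%N by rewrite NE leq_mul2r (leq_trans kq sR) orbT.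
have qk : (q * q.-1 <= q * k)%N by rewrite leq_mul2l kq orbT.
apply: leq_trans (_ : (q.-1 * q ^ 2 + q * q.-1 <= m)%N); last first.
  by rewrite -(subnKC Nm) leq_add // (leq_trans qk).
by case: (q) q0 => // u _; rewrite /= !expnS expn0; nia.
Qed.

(** In this degree the outer polynomials R and Q have degree q - 1, so scaling invariance leaves
    only their top and constant coefficients. These are read off at the coordinate points, first on
    the line X = 0 and then in the plane. *)
Lemma eq_scale_C2 : m = (q ^ 3 - q ^ 2)%N -> ev idfun 1 0 0 F != 0 ->
  exists2 t, t != 0 & F = t *: C2 K q.
Proof.
move=> mE F1; set t := ev idfun 1 0 0 F in F1 *.
have mE' : m = (q.-1 * q ^ 2)%N by rewrite mE; case: (q) q0 => // u _; rewrite /= !expnS expn0; nia.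
have fr2 := frob_alg hq (polyC \o @polyC K : {rmorphism K -> {poly {poly K}}}).
have [z [zp z0 zq]] := zeta_ex hq.
have zdvd j : z ^+ j = 1 -> (q.-1 %| j)%N by move=> /eqP; rewrite -(prim_order_dvd zp).
have q2 : (0 < q ^ 2)%N by rewrite expn_gt0 q0.
have sizeQ (A : idomainType) (Q W P : {poly A}) : P = Q \Po W -> size W = (q ^ 2).+1 ->
    (size P).-1 = m -> (size Q).-1 = q.-1.
  move=> -> sW; rewrite size_comp_poly sW mE' => /eqP.
  by rewrite eqn_pmul2r // => /eqP.
have fx0 : (0 : K) ^+ q = 0 by apply/eqP; exact: (frob_fix0 hq).
(* The exchange of X and Y fixes (1 : 1 : 0), where F is nonzero because an elation carries (0 : 1 :
   0) there; hence its scalar is 1. *)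
have F010 : ev idfun 0 1 0 F = t.
  have [[u u0 uE] _ _] := ev_swap hq Finv.
  have e := ev_translation hq Finv phi0 (expr1n _ q) fx0 idfun 0 1 0.
  rewrite /= !mul1r mulr0 add0r addr0 in e.
  have /eqP := uE _ idfun 1 1 0; rewrite e (uE _ idfun 1 0 0) -/t eq_sym -[X in _ == X]mul1r.
  by move=> /eqP /(mulIf (mulf_neq0 u0 F1)) /= ->; rewrite mul1r.
have F001 : ev idfun 0 0 1 F = t.
  have [_ _ [u u0 uE]] := ev_swap hq Finv.
  have e := ev_translation hq Finv phi0 fx0 (expr1n _ q) idfun 0 0 1.
  rewrite /= !mul1r mulr0 !add0r in e.
  have /eqP := uE _ idfun 1 0 1; rewrite e (uE _ idfun 1 0 0) -/t eq_sym -[X in _ == X]mul1r.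
  by move=> /eqP /(mulIf (mulf_neq0 u0 F1)) /= ->; rewrite mul1r.
have phE : phi = t *: (U ^+ q.-1 + 1).
  have [R RE] := ev_line_comp hq Finv phi0.
  have top : phi`_m = t by rewrite (coef_ev_line_top Fm).
  have sphi : (size phi).-1 = m.
    apply/eqP; rewrite eqn_leq -ltnS prednK ?size_poly_gt0 // size_ev_line //=.
    rewrite -ltnS prednK ?size_poly_gt0 // ltnNge; apply: contra F1 => /(nth_default 0).
    by rewrite top => ->.
  have sR := sizeQ _ _ _ _ RE size_U sphi.
  have Rz : R \Po (z%:P * 'X) = R.
    apply: (@comp_poly_inj _ U); first by rewrite size_U ltnS.
    by rewrite -comp_polyA -U_scale // comp_polyA -RE (phi_torus hq).
  have sR' : (size R <= q.-1.+1)%N by rewrite -sR leqSpred.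
  have RE2 := scale_invariant_binomial qp zdvd Rz sR'.
  have R0 : R`_0 = t.
    rewrite -F001 -coef0_ev_line RE -!horner_coef0 horner_comp !hornerE.
    by rewrite (frob0 _ q0) subrr (frob0 _ q0).
  have Rq : R`_q.-1 = t.
    by rewrite -sR -lead_coefE -top -sphi -lead_coefE RE lead_coef_comp ?size_U // lead_U expr1n mulr1.
  by rewrite RE RE2 R0 Rq comp_polyD comp_polyM !comp_polyC comp_Xn_poly -mul_polyC; ring.
have bE : bi F = t%:P%:P * bi (C2 K q).
  have [Q QE] := bi_translation hq (bi_elation hq Finv phi0).
  have top : (bi F)`_m = t%:P by rewrite (coef_bi_top Fm).
  have b0 := bi_neq0 phi0.
  have sbi : (size (bi F)).-1 = m.
    apply/eqP; rewrite eqn_leq -ltnS prednK ?size_poly_gt0 // size_bi //=.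
    rewrite -ltnS prednK ?size_poly_gt0 // ltnNge; apply: contra F1 => /(nth_default 0).
    by rewrite top => /polyC_inj ->.
  have sQ := sizeQ _ _ _ _ QE (size_bW hq) sbi.
  have zP : (z%:P%:P : {poly {poly K}}) ^+ q = z%:P%:P by rewrite -!rmorphXn zq.
  have Qz : Q \Po (z%:P%:P * 'X) = Q.
    apply: (@comp_poly_inj _ (bW K q)); first by rewrite (size_bW hq) ltnS.
    rewrite -comp_polyA comp_polyM comp_polyC comp_polyX.
    have -> : z%:P%:P * bW K q = bW K q \Po (z%:P%:P * 'X).
      rewrite /bW (rmorph_dW (comp_poly _)) /= comp_polyX comp_polyC rmorph1.
      by rewrite dW_scale.
    rewrite comp_polyA -QE.
    rewrite -[RHS](ev_torus hq Finv phi0 z0 zq (polyC \o @polyC K)).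
    apply: (ev_comp (g := comp_poly _)) => [c|||] /=.
    - by rewrite comp_polyC.
    - by rewrite comp_polyX.
    - by rewrite comp_polyC.
    - by rewrite -polyC1 comp_polyC.
  have sQ' : (size Q <= q.-1.+1)%N by rewrite -sQ leqSpred.
  have zdvd' j : (z%:P : {poly K}) ^+ j = 1 -> (q.-1 %| j)%N.
    by rewrite -rmorphXn => /polyC_inj /zdvd.
  have QE2 := scale_invariant_binomial qp zdvd' Qz sQ'.
  have bW0 := coef0_bW hq.
  (* W vanishes at X = 0, so the constant coefficient of Q is the restriction computed above, which
     equals t D^q. *)
  have Q0 : Q`_0 = phi.
    by rewrite -bi_coef0 QE -!horner_coef0 horner_comp [(bW K q).[0]]horner_coef0 bW0.
  have Qq : Q`_q.-1 = t%:P.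
    rewrite -sQ -lead_coefE -top -sbi -lead_coefE QE lead_coef_comp ?(size_bW hq) ?ltnS //.
    by rewrite (eqP (monic_bW hq)) expr1n mulr1.
  rewrite QE QE2 Q0 Qq comp_polyD comp_polyM !comp_polyC comp_Xn_poly phE.
  rewrite /bi ev_C2 /dC2 -/(bW K q) mulrDr; congr (_ + _).
  rewrite -[1]/(1%:P) -(rmorph_dD polyC) -rmorphXn -polyCM mul_polyC; congr (_ *: _)%:P.
  rewrite /dD /dV !expr1n mulr1 [RHS]fr /= expr1n; congr (_ + _).
  by rewrite exprAC.
exists t => //; apply: (bi_inj Fm); first by rewrite rpredZ // mE (C2_homog hq).
by rewrite bE /bi mmapZ.
Qed.

End Form.
End Uniqueness.

(** * Irreducibility of the form of degree q^3 - q *)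

Section IrreducibleC1.
Variables (K : closedFieldType) (p q : nat).
Hypothesis hq : alg_closure_of_Fq K p q.
Let q1 := q_gt1 hq.
Let q0 := q_gt0 hq.
Let qp := predq_gt0 hq.

Lemma msize_homog0 (F : {mpoly K[3]}) : F \is 0.-homog -> (msize F <= 1)%N.
Proof.
move=> /dhomogP F0; rewrite msizeE big_seq; elim/big_ind: _ => // [u v|mo /F0 ->] //.
by rewrite geq_max => -> ->.
Qed.

Lemma msize_homog_gt1 m (F : {mpoly K[3]}) : (0 < m)%N -> F != 0 -> F \is m.-homog ->
  (1 < msize F)%N.
Proof.
move=> m0 F0 Fm; rewrite ltnNge; apply/negP => /msize1_polyC Fc.
have := ev_homog Fm idfun 0 0 0 0; rewrite expr0n (gtn_eqF m0) !mul0r Fc mmapC /= => c0.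
by rewrite Fc c0 eqxx in F0.
Qed.

(** A factor with constant affine part is a multiple of Z^k, and k > 0 is excluded by a point of Z =
    0 off the curve. *)
Lemma factor_bi_const m (F A B : {mpoly K[3]}) c x y : F \is m.-homog -> F = A * B ->
  ev idfun x y 0 F != 0 -> bi A = c%:P%:P -> (msize A <= 1)%N.
Proof.
move=> Fm FAB Fxy Ac.
have F0 : F != 0 by apply: contraNneq Fxy => ->; rewrite mmap0.
have [k Ak] := homog_factor F0 Fm FAB.
have AE := bi_const Ak Ac.
have [k0|k0] := posnP k; first by apply: msize_homog0; rewrite k0 in Ak.
case/negP: Fxy; rewrite FAB rmorphM /= AE mmapZ rmorphXn /=.
by have [_ _ ->] := ev_X idfun x y 0; rewrite expr0n (gtn_eqF k0) mulr0 mul0r.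
Qed.

Local Notation V := ('X^q - 'X : {poly K}).
Local Notation D := (dD q 'X 1 : {poly K}).
Local Notation M := (dM q 'X 1 : {poly K}).

Lemma dD_X1 : D = V ^+ q.-1 + 1.
Proof. by rewrite /dD /dV !expr1n mulr1. Qed.

Lemma dM_X1 : M = V ^+ q.-1.
Proof. by rewrite /dM /dV expr1n mulr1 mul1r. Qed.

Let fr := frob_alg hq idfun.
Lemma dD_root : exists2 th : K, D.[th] = 0 & V.[th] ^+ q.-1 = -1.
Proof.
have sV : size V = q.+1.
  by rewrite size_polyDl ?size_polyN ?size_polyXn ?size_polyX ?ltnS.
have [|th Dth] := closed_rootP D _.
  have sVq : size (V ^+ q.-1) = (q * q.-1).+1.
    have := size_exp V q.-1; rewrite sV /= => <-; rewrite prednK // size_poly_gt0.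
    by rewrite expf_neq0 // -size_poly_eq0 sV.
  rewrite dD_X1 size_polyDl sVq ?size_poly1 ?ltnS ?muln_gt0 ?q0 //.
  by rewrite eqSS -lt0n muln_gt0 q0.
exists th; first exact/eqP.
move: Dth; rewrite rootE dD_X1 hornerD horner_exp hornerC addr_eq0 => /eqP ->.
by [].
Qed.

(** Since V' = -1 and q - 1 = -1 in K, the derivative of D = V^(q-1) + 1 is V^(q-2), which is
    nonzero where V^(q-1) = -1. *)
Lemma dD_deriv_root th : D.[th] = 0 -> D^`().[th] != 0.
Proof.
rewrite dD_X1 => Dth.
have Vth : V.[th] ^+ q.-1 = -1.
  by apply/eqP; rewrite -addr_eq0; apply/eqP; rewrite -[RHS]Dth [RHS]hornerD horner_exp hornerC.
have V' : V^`() = -1.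
  by rewrite derivB derivXn derivX -mulr_natl -polyC_natr (pchar_q hq) mul0r sub0r.
have qN1 : q.-1%:R = -1 :> {poly K}.
  apply/eqP; rewrite -subr_eq0 opprK natr1 (prednK q0) -polyC_natr (pchar_q hq) //.
have -> : (V ^+ q.-1 + 1)^`() = V ^+ q.-1.-1.
  rewrite derivD deriv_exp V' -[1 in X in _ + X]/(1%:P) derivC addr0.
  by rewrite -mulr_natl qN1 mulrA mulrNN mul1r mul1r.
apply/eqP => D'0; have /eqP := Vth.
rewrite -(prednK qp) exprS -horner_exp D'0 mulr0 eq_sym oppr_eq0 oner_eq0 //.
Qed.

Lemma bi_C1 : bi (C1 K q) = D%:P * bW K q ^+ q.-1 + (M ^+ q)%:P.
Proof.
rewrite /bi ev_C1 /dC1 -/(bW K q) (rmorph_dD polyC) rmorphXn (rmorph_dM polyC).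
by rewrite rmorph1.
Qed.

(* Modulo a root [th] of [D] the polynomial [bi C1] is a nonzero constant, while
   its leading coefficient [D] vanishes simply at [th] (Eisenstein's criterion read
   from the top): two factors of positive degree would both have a leading
   coefficient vanishing at [th]. *)
Lemma factor_C1 (A B : {mpoly K[3]}) : C1 K q = A * B ->
  (size (bi A) <= 1)%N \/ (size (bi B) <= 1)%N.
Proof.
move=> AB; have [th Dth Vth] := dD_root.
have D0 : D != 0.
  by apply: contraNneq (dD_deriv_root Dth) => ->; rewrite deriv0 horner0.
have PAB : bi A * bi B = D%:P * bW K q ^+ q.-1 + (M ^+ q)%:P.
  by rewrite -bi_C1 AB /bi rmorphM.
have mono : bW K q ^+ q.-1 \is monic by apply: monic_exp; apply: monic_bW hq.
have lead : lead_coef (bi A) * lead_coef (bi B) = D.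
  rewrite -lead_coefM PAB lead_coefDl.
    by rewrite lead_coefM lead_coefC (eqP mono) mulr1.
  rewrite mul_polyC size_scale // (leq_ltn_trans (size_polyC_leq1 _)) //.
  have := size_exp (bW K q) q.-1; rewrite (size_bW hq) /=.
  case: (size _) => [|[|//]] /= /esym/eqP; rewrite muln_eq0 expn_eq0 /=;
  by rewrite !gtn_eqF.
pose g := map_poly (horner_eval th) : {poly {poly K}} -> {poly K}.
have gAB : g (bi A) * g (bi B) = ((-1) ^+ q)%:P.
  rewrite /g -rmorphM PAB rmorphD !rmorphM /= !map_polyC /= !horner_evalE Dth mul0r add0r.
  by rewrite horner_exp dM_X1 horner_exp Vth.
have gAB0 : g (bi A) * g (bi B) != 0.
  by rewrite gAB polyC_eq0 expf_neq0 // oppr_eq0 oner_neq0.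
have gsize : (size (g (bi A)) <= 1)%N /\ (size (g (bi B)) <= 1)%N.
  have := congr1 (size : {poly K} -> nat) gAB.
  move: gAB0; rewrite mulf_eq0 => /norP[gA gB]; rewrite size_mul // => E.
  have := size_polyC_leq1 ((-1) ^+ q : K); rewrite -E.
  move: gA gB; rewrite -!size_poly_gt0.
  by case: (size _) (size _) => [|[|u]] [|[|v]] //=; rewrite ?addnS ?addSn.
have leadth (P : {poly {poly K}}) : (1 < size P)%N -> (size (g P) <= 1)%N ->
    (lead_coef P).[th] = 0.
  move=> sP sgP; rewrite -horner_evalE lead_coefE -coef_map nth_default //.
  by rewrite (leq_trans sgP) // -ltnS prednK // ltnW.
have [|sA] := leqP (size (bi A)) 1; first by left.
have [|sB] := leqP (size (bi B)) 1; first by right.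
have [gA gB] := gsize.
have /eqP[] := dD_deriv_root Dth.
by rewrite -lead derivM hornerD !hornerM (leadth _ sA gA) (leadth _ sB gB) mulr0 mul0r addr0.
Qed.

(** At (th : 1 : 0) the form reduces to W^(q-1) with W = V(th)^q, which gives (-1)^q. *)
Lemma C1_nonzero_at : exists2 th : K, D.[th] = 0 & ev idfun th 1 0 (C1 K q) != 0.
Proof.
have [th Dth Vth] := dD_root; exists th => //.
have e0 : (0 : K) ^+ q.-1 = 0 by rewrite expr0n (gtn_eqF qp).
have e1 : (0 : K) ^+ (q * q.-1) = 0 by rewrite expr0n gtn_eqF // muln_gt0 q0.
have V10 : dV q 1 0 = 1 :> K by rewrite /dV e0 mulr0 subr0 expr1n.
have D10 : dD q 1 0 = 1 :> K by rewrite /dD V10 e1 expr1n addr0.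
have M10 : dM q 1 0 = 0 :> K by rewrite /dM mul0r e0.
rewrite ev_C1 /dC1 /dW D10 M10 !mul1r mul0r (frob0 _ q0) !addr0 exprq2 -(frobB q0 fr).
have -> : th ^+ q - th = V.[th] by rewrite hornerD hornerN hornerXn hornerX.
by rewrite exprAC Vth expf_neq0 // oppr_eq0 oner_neq0.
Qed.

(** A factor [a] in K[Y] divides all coefficients in X, so a root of [a] is a root of both D and M;
    but D = M + 1 in the chart Z = 1. Hence [a] is constant. *)
Lemma factor_C1_const (A B : {mpoly K[3]}) : C1 K q = A * B ->
  (size (bi A) <= 1)%N -> (msize A <= 1)%N.
Proof.
move=> AB sA.
have PAB : bi A * bi B = D%:P * bW K q ^+ q.-1 + (M ^+ q)%:P.
  by rewrite -bi_C1 AB /bi rmorphM.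
have mono : bW K q ^+ q.-1 \is monic by apply: monic_exp; apply: monic_bW hq.
have bW0 := coef0_bW hq.
have [c cE] : exists c : K, bi A = c%:P%:P.
  move: PAB; rewrite (size1_polyC sA); set a := (bi A)`_0 => PAB.
  have aM : a * (bi B)`_0 = M ^+ q.
    have := congr1 (fun u : {poly {poly K}} => u.[0]) PAB.
    by rewrite /= hornerD !hornerM !hornerC horner_exp !horner_coef0 bW0 expr0n gtn_eqF // mulr0 add0r.
  have aD (y : K) : a.[y] = 0 -> D.[y] = 0.
    move=> ay; pose g := map_poly (horner_eval y) : {poly {poly K}} -> {poly K}.
    have My : M.[y] ^+ q = 0 by rewrite -horner_exp -aM hornerM ay mul0r.
    have := congr1 g PAB; rewrite /g rmorphM rmorphD rmorphM /= !map_polyC /= !horner_evalE.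
    rewrite ay mul0r horner_exp My addr0 => /esym/eqP; rewrite mulf_eq0 polyC_eq0.
    case/orP => [/eqP //|]; rewrite rmorphXn /= => /eqP E.
    have := monic_map (horner_eval y) (monic_bW hq).
    by move=> /(monic_exp q.-1) /monic_neq0; rewrite E eqxx.
  have [a1|/closed_rootP/sigW] := eqVneq (size a) 1%N.
    by exists a`_0; rewrite -size1_polyC ?a1.
  case=> y; rewrite rootE => /eqP ay; have Dy := aD y ay.
  have My : M.[y] ^+ q = 0 by rewrite -horner_exp -aM hornerM ay mul0r.
  move/eqP: My; rewrite expf_eq0 dM_X1 => /andP[_ /eqP My].
  move: Dy; rewrite dD_X1 hornerD My hornerC add0r => /eqP; rewrite oner_eq0 //.
have [x _ ev0] := C1_nonzero_at; exact: factor_bi_const (C1_homog hq) AB ev0 cE.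
Qed.

Lemma irreducible_C1 : irreducible_mpoly (C1 K q).
Proof.
split.
  apply: (msize_homog_gt1 _ _ (C1_homog hq)).
    by rewrite subn_gt0 -{1}(expn1 q) ltn_exp2l.
  by have [th _ ev0] := C1_nonzero_at; apply: contraNneq ev0 => ->; rewrite mmap0.
move=> A B AB; have [sA|sB] := factor_C1 AB; [left|right].
  exact: factor_C1_const AB sA.
by apply: factor_C1_const sB; rewrite AB mulrC.
Qed.

End IrreducibleC1.

(** * Irreducibility of the DGZ form *)

Section IrreducibleC2.
Variables (K : closedFieldType) (p q : nat).
Hypothesis hq : alg_closure_of_Fq K p q.
Let q1 := q_gt1 hq.
Let q0 := q_gt0 hq.
Let qp := predq_gt0 hq.
Implicit Types A B : {mpoly K[3]}.

(** Both D(v + u, 1) and D(v, 1) = 0 are (q-1)-th powers plus 1, and a difference of powers is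
    divisible by the difference of the bases. *)
Lemma dD_shift (S : comNzRingType) (v u : S) :
  {morph (fun x : S => x ^+ q) : x y / x + y} -> (v ^+ q - v) ^+ q.-1 = -1 ->
  exists e, dD q (v + u) 1 = e * u.
Proof.
move=> fr v1; have -> : dD q (v + u) 1 =
    ((v ^+ q - v) + (u ^+ q.-1 - 1) * u) ^+ q.-1 - (v ^+ q - v) ^+ q.-1.
  rewrite v1 opprK /dD /dV !expr1n mulr1 fr mulrBl mul1r -exprSr prednK //.
  by congr (_ ^+ _ + _); ring.
rewrite subrXX addrAC subrr add0r mulrAC; by eexists.
Qed.

Lemma dW_factor (S : comNzRingType) (x y z : S) : exists e, dW q x y z = e * x.
Proof.
have qq : (0 < q ^ 2)%N by rewrite expn_gt0 q0.
exists (x ^+ (q ^ 2).-1 - dD q y z * x ^+ q.-1 + dM q y z).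
by rewrite mulrDl mulrBl -mulrA -!exprSr !prednK.
Qed.

Lemma dW_x0 (S : comNzRingType) (y z : S) : dW q 0 y z = 0.
Proof. by have [e ->] := dW_factor 0 y z; rewrite mulr0. Qed.

Lemma dC2_x0 (S : comNzRingType) (y z : S) : dC2 q 0 y z = dD q y z ^+ q.
Proof. by rewrite /dC2 dW_x0 expr0n gtn_eqF // add0r. Qed.

Section CommonRoot.
Variables (A B : {mpoly K[3]}) (th : K).
Hypothesis AB : C2 K q = A * B.
Hypothesis Dth : (dD q 'X 1 : {poly K}).[th] = 0.

Let evAB (S : comNzRingType) (i : {rmorphism K -> S}) x y z :
  ev i x y z A * ev i x y z B = dC2 q x y z.
Proof. by rewrite -(ev_C2 q i) AB rmorphM. Qed.

Let Vth : (th ^+ q - th) ^+ q.-1 = -1.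
Proof.
move: Dth; rewrite dD_X1 hornerD horner_exp hornerD hornerXn hornerN hornerX hornerC => /eqP.
by rewrite addr_eq0 => /eqP.
Qed.

Let dDth : dD q th 1 = 0.
Proof. by rewrite /dD /dV !expr1n mulr1 Vth addNr. Qed.

Let dMth : dM q th 1 = -1.
Proof. by rewrite /dM /dV !expr1n mulr1 mul1r Vth. Qed.

(* Intersection multiplicity with the line [Y = th Z] at the point (0 : th : 1). *)
Lemma val_horizontal : exists j l (a b : {poly K}),
  [/\ a`_0 != 0, b`_0 != 0, (j + l <= q.-1)%N,
      ev (@polyC K) 'X th%:P 1 A = a * 'X^j & ev (@polyC K) 'X th%:P 1 B = b * 'X^l].
Proof.
have qq : (0 < (q ^ 2).-1)%N by move: q1; rewrite expnS expn1; case: (q) => [|[|u]]; rewrite /=; nia.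
have E : ev (@polyC K) 'X th%:P 1 A * ev (@polyC K) 'X th%:P 1 B =
    ('X^((q ^ 2).-1) - 1) ^+ q.-1 * 'X^(q.-1).
  have Dp : dD q th%:P 1 = 0 :> {poly K} by rewrite -polyC1 -(rmorph_dD polyC) dDth.
  have Mp : dM q th%:P 1 = -1 :> {poly K}.
    by rewrite -[in LHS]polyC1 -(rmorph_dM polyC) dMth rmorphN1.
  rewrite evAB /dC2 /dW Dp Mp mul0r subr0.
  rewrite (expr0n _ q) gtn_eqF // addr0 -exprMn mulrBl -exprSr prednK ?expn_gt0 ?q0 //.
  by rewrite mulN1r mul1r.
have c0 : (('X^((q ^ 2).-1) - 1 : {poly K}) ^+ q.-1)`_0 != 0.
  by rewrite -horner_coef0 horner_exp !hornerE expr0n gtn_eqF // sub0r expf_neq0 // oppr_eq0 oner_neq0.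
have n0 : ev (@polyC K) 'X th%:P 1 A * ev (@polyC K) 'X th%:P 1 B != 0.
  rewrite E mulf_neq0 // -?size_poly_eq0 ?size_polyXn //.
  by rewrite size_poly_eq0; apply: contraNneq c0 => ->; rewrite coef0.
move: n0; rewrite mulf_eq0 => /norP[/poly_valuation[j [a a0 aE]] /poly_valuation[l [b b0 bE]]].
exists j, l, a, b; split=> //.
apply: (poly_valuation_le c0 (r := a * b)); rewrite -E aE bE exprD; ring.
Qed.

(* Intersection multiplicity with the line [X = 0] at the same point. *)
Lemma val_vertical : exists j l (a b : {poly K}),
  [/\ a`_0 != 0, b`_0 != 0, (j + l <= q)%N,
      ev (@polyC K) 0 (th%:P + 'X) 1 A = a * 'X^j
    & ev (@polyC K) 0 (th%:P + 'X) 1 B = b * 'X^l].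
Proof.
pose D := dD q (th%:P + 'X) 1 : {poly K}.
have DE : D = dD q 'X 1 \Po ('X + th%:P).
  by rewrite (rmorph_dD (comp_poly _)) /= comp_polyX -polyC1 comp_polyC addrC.
have D1 : D`_1 != 0.
  have -> : D`_1 = (dD q 'X 1 : {poly K})^`().[th].
    have -> : D`_1 = D^`()`_0 by rewrite coef_deriv mulr1n.
    rewrite DE deriv_comp [('X + _)^`()]derivD derivX derivC addr0 mulr1 -horner_coef0 horner_comp.
    by rewrite hornerD hornerX hornerC add0r.
  exact: dD_deriv_root hq _ Dth.
have D0 : D != 0 by apply: contraNneq D1 => ->; rewrite coef0.
have [n [d d0 dE]] := poly_valuation D0.
have n1 : (n <= 1)%N.
  by rewrite leqNgt; apply: contra D1 => n1; rewrite dE coefMXn n1.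
have E : ev (@polyC K) 0 (th%:P + 'X) 1 A * ev (@polyC K) 0 (th%:P + 'X) 1 B =
    d ^+ q * 'X^(n * q).
  by rewrite evAB dC2_x0 -/D dE exprMn exprM.
have dq0 : (d ^+ q)`_0 != 0 by rewrite -horner_coef0 horner_exp horner_coef0 expf_neq0.
have n0 : ev (@polyC K) 0 (th%:P + 'X) 1 A * ev (@polyC K) 0 (th%:P + 'X) 1 B != 0.
  by rewrite evAB dC2_x0 expf_neq0.
move: n0; rewrite mulf_eq0 => /norP[/poly_valuation[j [a a0 aE]] /poly_valuation[l [b b0 bE]]].
exists j, l, a, b; split=> //.
apply: leq_trans (_ : (n * q <= q)%N); last by rewrite -{2}(mul1n q) leq_mul2r n1 orbT.
apply: (poly_valuation_le dq0 (r := a * b)); rewrite -E aE bE exprD; ring.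
Qed.

Local Notation S := {poly {mpoly K[2]}}.
Let i : {rmorphism K -> S} := polyC \o @mpolyC 2 K.
(** A generic arc through (0 : th : 1): the polynomial variable records the weights q and q - 1, and
    'X_0, 'X_1 are independent coefficients. Setting them to (1, 0) or (0, 1) in [spec] recovers the
    horizontal and vertical restrictions. *)
Let x : S := ('X_0)%:P * 'X^q.
Let y : S := (th%:MP)%:P + ('X_1)%:P * 'X^(q.-1).

Let spec (u v : K) : {rmorphism S -> {poly K}} := map_poly (meval (tnth [tuple u; v])).

Let specE u v (F : {mpoly K[3]}) : spec u v (ev i x y 1 F) =
  ev (@polyC K) (u%:P * 'X^q) (th%:P + v%:P * 'X^(q.-1)) 1 F.
Proof.
have mX k (c : {mpoly K[2]}) : map_poly (meval (tnth [tuple u; v])) (c%:P * 'X^k) =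
    (meval (tnth [tuple u; v]) c)%:P * 'X^k.
  by rewrite rmorphM /= map_polyXn map_polyC.
apply: (ev_comp (g := spec u v)) => [c|||].
- by rewrite /= map_polyC /= mevalC.
- by rewrite /= mX mevalXU (tnth_nth 0).
- by rewrite /y rmorphD /= mX mevalXU (tnth_nth 0) map_polyC /= mevalC.
- exact: rmorph1.
Qed.

(* Give X weight q and Y - th weight q - 1. The lowest weighted part of C2 at
   (0 : th : 1) has the single Newton segment X^(q-1), (Y - th)^q, and gcd(q, q-1) = 1,
   so that only one of two factors can vanish there. *)
Lemma no_common_root : (ev (@polyC K) 0 'X 1 A).[th] = 0 -> (ev (@polyC K) 0 'X 1 B).[th] = 0 -> False.
Proof.
move=> Ath Bth.
have [j [l [a [b [a0 b0 jl aE bE]]]]] := val_horizontal.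
have [j' [l' [a' [b' [a0' b0' jl' aE' bE']]]]] := val_vertical.
have comp_line F : ev (@polyC K) 0 (th%:P + 'X) 1 F = ev (@polyC K) 0 'X 1 F \Po ('X + th%:P).
  apply/esym; apply: (ev_comp (g := comp_poly _)) => [c|||] /=.
  - by rewrite comp_polyC.
  - exact: comp_poly0.
  - by rewrite comp_polyX addrC.
  - by rewrite -polyC1 comp_polyC.
have pos F (c : {poly K}) k : (ev (@polyC K) 0 'X 1 F).[th] = 0 -> c`_0 != 0 ->
    ev (@polyC K) 0 (th%:P + 'X) 1 F = c * 'X^k -> (0 < k)%N.
  move=> Fth c0 FE; rewrite lt0n; apply: contraNneq c0 => k0.
  move: FE; rewrite k0 expr0 mulr1 => <-.
  by rewrite comp_line -horner_coef0 horner_comp !hornerE Fth.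
have j'0 := pos _ _ _ Ath a0' aE'; have l'0 := pos _ _ _ Bth b0' bE'.
have horiz F (c : {poly K}) k : ev (@polyC K) 'X th%:P 1 F = c * 'X^k ->
    spec 1 0 (ev i x y 1 F) = (c \Po 'X^q) * 'X^(q * k).
  move=> FE; rewrite specE mul0r addr0 mul1r.
  rewrite exprM -(comp_Xn_poly _ k) -comp_polyM -FE; apply/esym.
  apply: (ev_comp (g := comp_poly _)) => [e|||] /=.
  - by rewrite comp_polyC.
  - by rewrite comp_polyX.
  - by rewrite comp_polyC.
  - by rewrite -polyC1 comp_polyC.
have vert F (c : {poly K}) k : ev (@polyC K) 0 (th%:P + 'X) 1 F = c * 'X^k ->
    spec 0 1 (ev i x y 1 F) = (c \Po 'X^(q.-1)) * 'X^(q.-1 * k).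
  move=> FE; rewrite specE mul0r mul1r.
  rewrite exprM -(comp_Xn_poly _ k) -comp_polyM -FE; apply/esym.
  apply: (ev_comp (g := comp_poly _)) => [e|||] /=.
  - by rewrite comp_polyC.
  - exact: comp_poly0.
  - by rewrite comp_polyD comp_polyC comp_polyX.
  - by rewrite -polyC1 comp_polyC.
have comp0 (c : {poly K}) k : (0 < k)%N -> c`_0 != 0 -> (c \Po 'X^k)`_0 != 0.
  by move=> k0 c0; rewrite -horner_coef0 horner_comp hornerXn expr0n gtn_eqF // horner_coef0.
have nz F (c : {poly K}) k : c`_0 != 0 -> ev (@polyC K) 'X th%:P 1 F = c * 'X^k ->
    ev i x y 1 F != 0.
  move=> c0 /horiz FE; apply: contraNneq (comp0 _ _ q0 c0) => F0.
  move: FE; rewrite F0 rmorph0 => /esym/eqP; rewrite mulf_eq0 => /orP[/eqP -> |].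
    by rewrite coef0.
  by rewrite -size_poly_eq0 size_polyXn.
have [w1 [s s0 sE]] := poly_valuation (nz _ _ _ a0 aE).
have [w2 [t t0 tE]] := poly_valuation (nz _ _ _ b0 bE).
have specM u v (c : S) k : spec u v (c * 'X^k) = spec u v c * 'X^k.
  by rewrite rmorphM /= map_polyXn.
have w1q : (w1 <= q * j)%N.
  apply: (poly_valuation_le (comp0 _ _ q0 a0) (r := spec 1 0 s)).
  by rewrite -specM -sE; apply: horiz.
have w2q : (w2 <= q * l)%N.
  apply: (poly_valuation_le (comp0 _ _ q0 b0) (r := spec 1 0 t)).
  by rewrite -specM -tE; apply: horiz.
have w1p : (w1 <= q.-1 * j')%N.
  apply: (poly_valuation_le (comp0 _ _ qp a0') (r := spec 0 1 s)).
  by rewrite -specM -sE; apply: vert.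
have w2p : (w2 <= q.-1 * l')%N.
  apply: (poly_valuation_le (comp0 _ _ qp b0') (r := spec 0 1 t)).
  by rewrite -specM -tE; apply: vert.
(* Both W^(q-1) and D^q have weight at least q(q-1) along the arc, because x divides W and Y - th
   divides D. *)
have w12 : (q * q.-1 <= w1 + w2)%N.
  have frS := frob_alg hq i.
  have [e eE] := dW_factor x y 1.
  have [f fE] : exists f, dD q y 1 = f * (('X_1)%:P * 'X^(q.-1)).
    by apply: dD_shift frS _; rewrite -!rmorphXn -!rmorphB -!rmorphXn Vth !rmorphN !rmorph1.
  have st0 : (s * t)`_0 != 0 by rewrite coef0M mulf_neq0.
  apply: (poly_valuation_le st0 (r := (e * ('X_0)%:P) ^+ q.-1 + (f * ('X_1)%:P) ^+ q)).
  transitivity (dC2 q x y 1); last first.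
    by rewrite -(evAB i) sE tE exprD; ring.
  rewrite /dC2 eE fE /x !mulrA [in RHS]exprMn [in X in _ = _ + X]exprMn -!exprM mulrDl.
  by rewrite [(q.-1 * q)%N]mulnC.
(* The upper bounds for w1 + w2 sum to at most q(q-1) both ways, so all inequalities are
   equalities. *)
have w1E : (q * j = q.-1 * j')%N by nia.
have : (q %| j')%N.
  rewrite -(Gauss_dvdr j' (_ : coprime q q.-1)) -?w1E ?dvdn_mulr //.
  by rewrite coprime_sym -{2}(prednK q0) coprimenS.
(* j' would be at least q, whereas l' > 0 and j' + l' is at most q. *)
move/dvdn_leq => /(_ j'0); lia.
Qed.

End CommonRoot.
End IrreducibleC2.

(** * Factors of the DGZ form and their symmetries *)

Section FactorsOfC2.
Variables (K : closedFieldType) (p q : nat).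
Hypothesis hq : alg_closure_of_Fq K p q.
Let q1 := q_gt1 hq.
Let q0 := q_gt0 hq.
Let qp := predq_gt0 hq.
Implicit Types A B : {mpoly K[3]}.
Local Notation line F := (ev (@polyC K) 0 'X 1 F).

Lemma evAB A B : C2 K q = A * B -> forall (S : comNzRingType) (i : {rmorphism K -> S}) x y z,
  ev i x y z A * ev i x y z B = dC2 q x y z.
Proof. by move=> AB S i x y z; rewrite -(ev_C2 q i) AB rmorphM. Qed.

Lemma dC2_100 : dC2 q 1 0 0 = 1 :> K.
Proof.
have e0 : (0 : K) ^+ q.-1 = 0 by rewrite expr0n gtn_eqF.
have D0 : dD q 0 0 = 0 :> K.
  by rewrite /dD /dV (frob0 _ q0) mul0r subr0 exprM (frob0 _ q0) e0 addr0.
have M0 : dM q 0 0 = 0 :> K by rewrite /dM mul0r e0.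
by rewrite /dC2 /dW D0 M0 !mul0r subr0 addr0 !expr1n (frob0 _ q0) addr0.
Qed.

Lemma dC2_010 : dC2 q 0 1 0 = 1 :> K.
Proof.
have e0 : (0 : K) ^+ q.-1 = 0 by rewrite expr0n gtn_eqF.
rewrite (dC2_x0 hq) /dD /dV e0 mulr0 subr0 !expr1n expr0n gtn_eqF ?addr0 ?expr1n //.
by rewrite muln_gt0 q0.
Qed.

Lemma C2_neq0 : C2 K q != 0.
Proof.
apply: contra_neq (oner_neq0 K) => C0.
by rewrite -dC2_100 -(ev_C2 q idfun) C0 mmap0.
Qed.

Lemma factor_homog A B : C2 K q = A * B -> exists k, A \is k.-homog.
Proof. exact: homog_factor C2_neq0 (C2_homog hq). Qed.

(** A does not vanish at (0 : 1 : 0), because the DGZ form takes the value 1 there; so no degree is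
    lost on X = 0. *)
Lemma size_factor_line A B k : C2 K q = A * B -> A \is k.-homog -> size (line A) = k.+1.
Proof.
move=> AB Ak; apply/eqP; rewrite eqn_leq size_ev_line //= ltnNge; apply/negP => sA.
have := evAB AB idfun 0 1 0; rewrite -(coef_ev_line_top Ak) nth_default // mul0r dC2_010.
by move/esym/eqP; rewrite oner_eq0.
Qed.

(** The product of the two restrictions is D^q, so a common root would be a root of D, which
    [no_common_root] excludes. *)
Lemma coprime_lines A B : C2 K q = A * B -> coprimep (line A) (line B).
Proof.
move=> AB; apply: Pdiv.ClosedField.root_coprimep => th /rootP Ath; apply/eqP => Bth.
apply: (no_common_root hq AB _ Ath Bth).
have := congr1 (horner^~ th) (evAB AB (@polyC K) 0 'X 1).
rewrite (dC2_x0 hq) /= hornerM Ath mul0r horner_exp => /esym/eqP.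
by rewrite expf_eq0 => /andP[_ /eqP].
Qed.

(* Hensel's uniqueness of coprime lifts along the line [X = 0]: the coefficient of
   [X^n] in a factor of degree k has degree < k = deg (line A) as soon as n > 0, hence it is
   determined modulo [line A]. *)
Lemma factor_unique A B A' B' : C2 K q = A * B -> C2 K q = A' * B' ->
  line A = line A' -> line B = line B' -> A = A'.
Proof.
move=> AB AB' lA lB.
have [k Ak] := factor_homog AB; have [k' Ak'] := factor_homog AB'.
have kk' : k = k'.
  have := size_factor_line AB Ak; rewrite lA (size_factor_line AB' Ak').
  by case.
rewrite -{k'}kk' in Ak'.
apply: (bi_inj Ak Ak'); apply/eqP; rewrite -subr_eq0; apply/eqP.
set U := bi A - bi A'; set V := bi B - bi B'.
(* Once lower coefficients of U and V vanish, the next coefficient of this relation only involves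
   the restrictions of A and B to X = 0. *)
have UV : U * bi B' + bi A * V = 0.
  have E1 : bi A * bi B = bi (C2 K q) by rewrite AB /bi rmorphM.
  have E2 : bi A' * bi B' = bi (C2 K q) by rewrite AB' /bi rmorphM.
  transitivity (bi A * bi B - bi A' * bi B'); first by rewrite /U /V; ring.
  by rewrite E1 E2 subrr.
suff UV0 n : U`_n = 0 /\ V`_n = 0 by apply/polyP => n; rewrite coef0; case: (UV0 n).
elim/ltn_ind: n => -[_|n IH].
  by rewrite !coefB !bi_coef0 lA lB !subrr.
have := congr1 (fun P : {poly {poly K}} => P`_n.+1) UV.
rewrite coef0 coefD coefM coefMr big_ord_recr /= subnn big1 ?add0r => [|j _]; last first.
  by case: (IH j (ltn_ord j)) => -> _; rewrite mul0r.
rewrite big_ord_recr /= subnn big1 ?add0r => [|j _]; last first.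
  by case: (IH j (ltn_ord j)) => _ ->; rewrite mulr0.
rewrite !bi_coef0 -lB => E.
have Un : U`_n.+1 = 0.
  apply/eqP; apply: contraT => Un0.
  have : (line A %| U`_n.+1)%R.
    rewrite -(Gauss_dvdpl _ (coprime_lines AB)).
    have -> : U`_n.+1 * line B = - (line A * V`_n.+1) by apply/eqP; rewrite -addr_eq0 E.
    by rewrite -mulrN dvdp_mulr.
  move/(dvdp_leq Un0); rewrite (size_factor_line AB Ak) leqNgt ltnS coefB.
  rewrite (leq_trans (size_polyD _ _)) // size_polyN geq_max.
  have sz F : F \is k.-homog -> (size ((bi F)`_n.+1)%R <= k)%N.
    by move=> Fk; rewrite (leq_trans (size_coef_bi Fk _)) // subSS leq_subr.
  by rewrite !sz.
split=> //; move: E; rewrite Un mul0r add0r => /eqP; rewrite mulf_eq0 => /orP[|/eqP //].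
by rewrite -size_poly_eq0 (size_factor_line AB Ak).
Qed.

Lemma act_factor A B M : C2 K q = A * B -> GL3q q M -> C2 K q = act M A * act M B.
Proof. by move=> AB GM; rewrite -(act_C2 hq GM) AB /act rmorphM. Qed.

(** An elation with axis X = 0 maps the factorization to another with the same restrictions to the
    axis, hence to the same one. *)
Lemma factor_elation_X A B : C2 K q = A * B -> forall b c : K, b ^+ q = b -> c ^+ q = c ->
  forall (S : comNzRingType) (i : {rmorphism K -> S}) x y z,
  ev i x (y + i b * x) (z + i c * x) A = ev i x y z A.
Proof.
move=> AB b c bq cq S i x y z; pose M := mx3 1 0 0 b 1 0 c 0 1.
have evM F (T : comNzRingType) (j : {rmorphism K -> T}) u v w :
    ev j u v w (act M F) = ev j u (v + j b * u) (w + j c * u) F.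
  rewrite /M ev_act_mx3; congr (mmap _ (tnth [tuple _; _; _]) _); rewrite !(rmorph0, rmorph1); ring.
have GM : GL3q q M.
  apply: GL3q_mx3; first by rewrite /= !(frob_fix0 hq) !frob_fix1 bq cq !eqxx.
  by rewrite (_ : _ + _ = 1); [rewrite oner_neq0 | ring].
have lineM F : line F = line (act M F) by rewrite evM !mulr0 !addr0.
by rewrite -evM -(factor_unique AB (act_factor AB GM) (lineM A) (lineM B)).
Qed.

Lemma GL3q_swap12 : GL3q q (mx3 0 1 0 1 0 0 0 0 1 : 'M[K]_3).
Proof.
apply: GL3q_mx3; first by rewrite /= !(frob_fix0 hq) !frob_fix1.
by rewrite (_ : _ + _ = -1); [rewrite oppr_eq0 oner_neq0 | ring].
Qed.

Lemma GL3q_swap13 : GL3q q (mx3 0 0 1 0 1 0 1 0 0 : 'M[K]_3).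
Proof.
apply: GL3q_mx3; first by rewrite /= !(frob_fix0 hq) !frob_fix1.
by rewrite (_ : _ + _ = -1); [rewrite oppr_eq0 oner_neq0 | ring].
Qed.

(** Conjugation by a coordinate exchange reduces to the axis X = 0; the exchanged factors still
    factor the invariant form. *)
Lemma factor_elation_Y A B : C2 K q = A * B -> forall b c : K, b ^+ q = b -> c ^+ q = c ->
  forall (S : comNzRingType) (i : {rmorphism K -> S}) x y z,
  ev i (x + i b * y) y (z + i c * y) A = ev i x y z A.
Proof.
move=> AB b c bq cq S i x y z.
have evM u v w : ev i u v w (act (mx3 0 1 0 1 0 0 0 0 1) A) = ev i v u w A.
  rewrite ev_act_mx3; congr (mmap _ (tnth [tuple _; _; _]) _); rewrite !(rmorph0, rmorph1); ring.
by rewrite -!evM (factor_elation_X (act_factor AB GL3q_swap12)).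
Qed.

Lemma factor_elation_Z A B : C2 K q = A * B -> forall b c : K, b ^+ q = b -> c ^+ q = c ->
  forall (S : comNzRingType) (i : {rmorphism K -> S}) x y z,
  ev i (x + i b * z) (y + i c * z) z A = ev i x y z A.
Proof.
move=> AB b c bq cq S i x y z.
have evM u v w : ev i u v w (act (mx3 0 0 1 0 1 0 1 0 0) A) = ev i w v u A.
  rewrite ev_act_mx3; congr (mmap _ (tnth [tuple _; _; _]) _); rewrite !(rmorph0, rmorph1); ring.
by rewrite -!evM (factor_elation_X (act_factor AB GL3q_swap13)).
Qed.

Lemma factor_degree_dvd A B k : C2 K q = A * B -> A \is k.-homog -> (q ^ 2 * q.-1 %| k)%N.
Proof.
move=> AB Ak.
have zq0 : (0 : K) ^+ q = 0 by apply/eqP; exact: (frob_fix0 hq).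
apply: (degree_dvd hq Ak) => [a b aq bq|z z0 zq|].
- rewrite bi_shift; pose i := polyC \o @polyC K : {rmorphism K -> {poly {poly K}}}.
  have EZ := factor_elation_Z AB bq zq0 i ('X + i a * 'X%:P) 'X%:P 1.
  have EY := factor_elation_Y AB aq zq0 i 'X 'X%:P 1.
  rewrite rmorph0 mul0r addr0 in EZ; rewrite rmorph0 mul0r addr0 in EY.
  by rewrite EZ EY.
- pose fr := frob_alg hq idfun.
  have z1q : (z - 1) ^+ q = z - 1 by rewrite (frobB q0 fr) zq expr1n.
  have zVq : (- z^-1) ^+ q = - z^-1 by rewrite (frobN q0 fr) exprVn zq.
  (* Three elations replace the diagonal matrix: (1,0,0) goes to (1,1,0), then to (z,1,0), then to
     (z,0,0). *)
  have E1 := factor_elation_X AB zVq zq0 idfun z 1 0.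
  have E2 := factor_elation_Y AB z1q zq0 idfun 1 1 0.
  have E3 := factor_elation_X AB (expr1n _ q) zq0 idfun 1 0 0.
  rewrite /= mulNr mulVf // subrr mul0r addr0 in E1.
  rewrite /= mulr1 mul0r addr0 addrC subrK in E2.
  rewrite /= mulr1 mul0r add0r addr0 in E3.
  by rewrite E1 E2 E3.
- apply: contra_eq_neq (evAB AB idfun 1 0 0) => ->.
  by rewrite mul0r dC2_100 eq_sym oner_neq0.
Qed.

(** The degrees of two factors are multiples of their sum, so one of them is 0. *)
Lemma irreducible_C2 : irreducible_mpoly (C2 K q).
Proof.
have dE : (q ^ 3 - q ^ 2 = q ^ 2 * q.-1)%N.
  by case: (q) q0 => // u _; rewrite /= !expnS expn0; nia.
have d0 : (0 < q ^ 3 - q ^ 2)%N by rewrite dE muln_gt0 expn_gt0 q0.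
split; first exact: msize_homog_gt1 d0 C2_neq0 (C2_homog hq).
move=> A B AB; have BA : C2 K q = B * A by rewrite mulrC.
have [k Ak] := factor_homog AB; have [l Bl] := factor_homog BA.
have kl : (k + l)%N = (q ^ 2 * q.-1)%N.
  rewrite -dE; apply: (dhomog_uniq C2_neq0 _ (C2_homog hq)).
  by rewrite AB dhomogM.
have /dvdnP[k' kE] := factor_degree_dvd AB Ak; have /dvdnP[l' lE] := factor_degree_dvd BA Bl.
have N0 : (0 < q ^ 2 * q.-1)%N by rewrite -dE.
have [k0|k0] := posnP k; first by left; apply: msize_homog0; rewrite k0 in Ak.
have [l0|l0] := posnP l; first by right; apply: msize_homog0; rewrite l0 in Bl.
have := leq_add (dvdn_leq k0 (factor_degree_dvd AB Ak)) (dvdn_leq l0 (factor_degree_dvd BA Bl)).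
by rewrite kl -{3}[(q ^ 2 * _)%N]addn0 leq_add2l leqNgt N0.
Qed.

End FactorsOfC2.

(** * Degrees of the invariant irreducible curves *)

Section Degrees.
Variables (K : closedFieldType) (p q : nat).
Hypothesis hq : alg_closure_of_Fq K p q.
Let q1 := q_gt1 hq.
Let q0 := q_gt0 hq.

Lemma inv_irr_C2 : inv_irr_deg K q (q ^ 3 - q ^ 2).
Proof.
exists (C2 K q); split; [|exact: irreducible_C2 hq|exact: PGL_invariant_C2 hq].
by apply/homog_degP; rewrite (C2_neq0 hq) (C2_homog hq).
Qed.

Lemma inv_irr_C1 : inv_irr_deg K q (q ^ 3 - q).
Proof.
exists (C1 K q); split; [|exact: irreducible_C1 hq|exact: PGL_invariant_C1 hq].
apply/homog_degP; rewrite (C1_homog hq); split=> //.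
by have [th _] := C1_nonzero_at hq; apply: contraNneq => ->; rewrite mmap0.
Qed.

(** A form vanishing on X = 0 is divisible by X; irreducibility would make it that line, of degree
    1. *)
Lemma irreducible_line_neq0 m (F : {mpoly K[3]}) : m != 1%N -> F != 0 -> F \is m.-homog ->
  irreducible_mpoly F -> ev (@polyC K) 0 'X 1 F != 0.
Proof.
move=> m1 F0 Fm [_ irr]; apply/eqP => /(ev_line0_divX Fm)[G FG].
have X1 : 'X_0 \is [in K[3], 1.-homog] by rewrite dhomogX /= mdeg1.
have [sX|sG] := irr _ _ FG; first by rewrite msizeX mdeg1 in sX.
case/negP: m1; apply/eqP; apply: (dhomog_uniq F0 Fm).
rewrite FG (msize1_polyC sG) mulrC mul_mpolyC rpredZ //.
Qed.

Lemma degree_cases m (F : {mpoly K[3]}) : m != 1%N -> homog_deg m F -> irreducible_mpoly F ->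
  PGL3q_invariant q F ->
  [\/ m = (q ^ 3 - q ^ 2)%N /\ is_DGZ q F | (q ^ 3 - q <= m)%N].
Proof.
move=> m1 /homog_degP[F0 Fm] irr Finv.
have phi0 := irreducible_line_neq0 m1 F0 Fm irr.
have [F1|F1] := eqVneq (ev idfun 1 0 0 F) 0; first by right; have := degree_ge hq Fm Finv phi0 F1.
have tor z : z != 0 -> z ^+ q = z -> ev idfun z 0 0 F = ev idfun 1 0 0 F.
  by move=> z0 zq; have := ev_torus hq Finv phi0 z0 zq idfun 1 0 0; rewrite /= mulr1.
have /dvdnP[k mE] := degree_dvd hq Fm (bi_elation hq Finv phi0) tor F1.
have qE : (q ^ 3 - q ^ 2 = q ^ 2 * q.-1)%N.
  by case: (q) q0 => // u _; rewrite /= !expnS expn0; nia.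
(* Here m = k q^2 (q-1): k = 0 gives a constant, k = 1 the DGZ curve, and k >= 2 exceeds q^3 - q up
   to equality, the difference being at least q (q-1)^2. *)
case: k mE => [|[|k]] mE.
- have := msize_homog0 (F := F); rewrite leqNgt (proj1 irr).
  by move: Fm; rewrite mE mul0n => Fm /(_ Fm).
- rewrite mul1n -qE in mE; left; split=> //.
  have [t t0 ->] := eq_scale_C2 hq Fm Finv phi0 mE F1.
  by exists t; split=> //; rewrite /dehom comp_mpolyZ -scalerAl -/(dehom _) (dehom_C2 hq).
- right; rewrite mE; move: q1; case: (q) => [|[|u]] //= _.
  by rewrite !expnS expn0; nia.
Qed.

End Degrees.

Theorem mainTheorem7 (K : closedFieldType) (p q : nat) :
  alg_closure_of_Fq K p q ->
  [/\ is_d K q (q ^ 3 - q ^ 2)%N,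
      is_eps K q (q ^ 2 - q)%N
    & forall F : {mpoly K[3]},
        homog_deg (q ^ 3 - q ^ 2)%N F -> irreducible_mpoly F ->
        PGL3q_invariant q F -> is_DGZ q F].
Proof.
move=> hq; have q1 := q_gt1 hq.
have d1 : (1 < q ^ 3 - q ^ 2)%N.
  by case: (q) q1 => [|[|u]] //= _; rewrite !expnS expn0; nia.
have lt12 : (q ^ 3 - q ^ 2 < q ^ 3 - q)%N.
  by case: (q) q1 => [|[|u]] //= _; rewrite !expnS expn0; nia.
have dd : (q ^ 3 - q ^ 2 + (q ^ 2 - q) = q ^ 3 - q)%N.
  by case: (q) q1 => [|[|u]] //= _; rewrite !expnS expn0; nia.
have isd : is_d K q (q ^ 3 - q ^ 2)%N.
  split; [by rewrite gtn_eqF | exact: inv_irr_C2 hq | move=> m m1 [F [Fm irr Finv]]].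
  have [[-> _] //|le_m] := degree_cases hq m1 Fm irr Finv.
  exact: leq_trans (ltnW lt12) le_m.
split=> //.
- exists (q ^ 3 - q ^ 2)%N; split=> //.
  + by rewrite subn_gt0 -{1}(expn1 q) ltn_exp2l.
  + by rewrite dd; exact: inv_irr_C1 hq.
  + move=> m dm [F [Fm irr Finv]]; rewrite dd.
    have m1 : m != 1%N by rewrite gtn_eqF // (ltn_trans d1).
    have [[mE _]|//] := degree_cases hq m1 Fm irr Finv.
    by rewrite mE ltnn in dm.
- move=> F Fm irr Finv; have m1 : (q ^ 3 - q ^ 2)%N != 1%N by rewrite gtn_eqF.
  have [[_ //]|] := degree_cases hq m1 Fm irr Finv.
  by rewrite leqNgt lt12.
Qed.
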